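(* Let $2<p<\infty$, let $T$ be an $\ell_p$-strictly singular operator on $L_p$, and let $J$ be an isometric embedding of $L_p$ into an injective Banach space $Z$. Then for each $\varepsilon>0$ there is an operator $S:L_p\to Z$ such that $S$ factors through $\ell_2$ and $\|JT-S\|<\varepsilon$.
   Context: $L_p$ denotes $L_p(0,1)$ (equivalently, $L_p(\mu)$ for any purely non-atomic separable probability measure $\mu$). Operators are bounded and linear. An operator $T:X\to Y$ between Banach spaces is $\ell_p$-strictly singular if there is no closed subspace $Z_0$ of $X$ isomorphic to $\ell_p$ such that the restriction $T_{|Z_0}$ is an isomorphism onto its image. $S:L_p\to Z$ factors through $\ell_2$ if $S=BA$ for some bounded linear operators $A:L_p\to\ell_2$ and $B:\ell_2\to Z$. A Banach space $Z$ is injective if every bounded linear operator into $Z$ from a closed subspace of a Banach space extends to a bounded linear operator on the whole space. *)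

(* Defs.v *)
From HB Require Import structures.
From mathcomp Require Import all_boot all_order all_algebra.
From mathcomp Require Import all_classical all_reals all_analysis.
From mathcomp Require Import measurable_realfun ess_sup_inf.

Set Implicit Arguments.
Unset Strict Implicit.
Unset Printing Implicit Defensive.

Import Order.TTheory GRing.Theory Num.Theory.
Import numFieldNormedType.Exports.

Local Open Scope classical_set_scope.
Local Open Scope ring_scope.

(** The library type [LspaceType mu p1] of almost-everywhere classes of
    p-integrable real functions carries no algebraic structure; it is turned
    here into a normed space, the operations being those of representatives. *)
Section Lspace_normed.
Context d (T : measurableType d) (R : realType).
Variables (mu : {measure set T -> \bar R}) (p : \bar R) (p1 : (1 <= p)%E).

Local Notation L := (LspaceType mu p1).
Local Notation F := (LfunType mu p1).
Local Notation Q := {mfun_ mu, T >-> measurableTypeR R}.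

HB.instance Definition _ := gen_eqMixin L.
HB.instance Definition _ := gen_choiceMixin L.

Lemma Lrepr_subproof (u : L) : (u : T -> R) \in Lfun mu p.
Proof.
apply/andP; split; last by rewrite inE; exact: Lebesgue_finite.
by rewrite inE; exact: (@measurable_funPT _ _ _ _ (repr (u : Q))).
Qed.

Definition Lrepr (u : L) : F := Lfun_Sub p1 (Lrepr_subproof u).

Lemma ae_eq_Lnorm (f g : T -> R) :
  measurable_fun setT f -> measurable_fun setT g ->
  f = g %[ae mu] -> ('N[mu]_p[EFin \o f] = 'N[mu]_p[EFin \o g])%E.
Proof.
move=> mf mg fg; rewrite unlock /Lnorm; case: p => [r| |].
- congr (_ `^ _)%E; apply: ge0_ae_eq_integral => //.
  + apply: (measurableT_comp (measurable_poweR r)) => //.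
    by apply: measurableT_comp => //; exact/measurable_EFinP.
  + apply: (measurableT_comp (measurable_poweR r)) => //.
    by apply: measurableT_comp => //; exact/measurable_EFinP.
  + by move=> *; exact: poweR_ge0.
  + by move=> *; exact: poweR_ge0.
  + by apply: filterS fg => x /= /[apply] ->.
- case: ifP => // _; apply: eq_ess_sup.
  by apply: filterS fg => x /= /(_ I) ->.
- case: ifP => // _; apply: eq_ess_inf.
  by apply: filterS fg => x /= /(_ I) ->.
Qed.

Definition mfunR (f : F) : {mfun T >-> measurableTypeR R} :=
  HB.pack_for {mfun T >-> measurableTypeR R} (f : T -> measurableTypeR R)
    (isMeasurableFun.Build _ _ T (measurableTypeR R) f (@measurable_funPT _ _ _ _ f)).

Definition aeclass (f : F) : Q := \pi_Q%qT (mfunR f).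

Lemma aeclassE (f : F) : (aeclass f : T -> R) = f %[ae mu].
Proof.
have /eqmodP/asboolP : (repr (aeclass f) = mfunR f %[mod Q])%qT by rewrite reprK.
by [].
Qed.

Lemma aeclass_finite_norm (f : F) : finite_norm mu p (aeclass f).
Proof.
rewrite /finite_norm (@ae_eq_Lnorm _ f).
- exact: Lfunction_finite.
- exact: (@measurable_funPT _ _ _ _ (repr (aeclass f))).
- exact: measurable_funPT.
- exact: aeclassE.
Qed.

Definition Lclass (f : F) : L :=
  HB.pack_for L (aeclass f)
    (isFinLebesgue.Build d T R mu p p1 (aeclass f) (aeclass_finite_norm f)).

Lemma Lclass_repr (f : F) : Lrepr (Lclass f) = f %[ae mu].
Proof. exact: aeclassE. Qed.

Lemma Lspace_val_inj (u v : L) : (u : Q) = v -> u = v.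
Proof.
case: u v => [u [[fu]]] [v [[fv]]] /= uv.
by move: fu fv; rewrite uv => fu fv; rewrite (Prop_irrelevance fu fv).
Qed.

Lemma Lclass_eqP (f g : F) : Lclass f = Lclass g <-> f = g %[ae mu].
Proof.
split=> [fg|fg].
  apply: ae_eq_trans (Lclass_repr g); rewrite -fg.
  exact/ae_eq_sym/Lclass_repr.
by apply/Lspace_val_inj/eqmodP/asboolP.
Qed.

Lemma LreprK : cancel Lrepr Lclass.
Proof.
move=> u; apply: Lspace_val_inj; rewrite /= -[RHS](@reprK _ Q).
by apply/eqmodP/asboolP/ae_eq_refl.
Qed.

Definition Ladd (u v : L) : L := Lclass (Lrepr u + Lrepr v).
Definition Lopp (u : L) : L := Lclass (- Lrepr u).
Definition Lscale (a : R) (u : L) : L := Lclass (a *: Lrepr u).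
Definition Lspace_norm (u : L) : R := fine ('N[mu]_p[EFin \o u])%E.

Lemma LclassD (f g : F) : Ladd (Lclass f) (Lclass g) = Lclass (f + g).
Proof.
apply/Lclass_eqP; apply: (filterS2 _ _ (Lclass_repr f) (Lclass_repr g)).
by move=> x /(_ I) fx /(_ I) gx _; exact: (congr2 +%R fx gx).
Qed.

Lemma LclassN (f : F) : Lopp (Lclass f) = Lclass (- f).
Proof.
apply/Lclass_eqP; apply: filterS (Lclass_repr f) => x /(_ I) fx _.
exact: (congr1 -%R fx).
Qed.

Lemma LclassZ a (f : F) : Lscale a (Lclass f) = Lclass (a *: f).
Proof.
apply/Lclass_eqP; apply: filterS (Lclass_repr f) => x /(_ I) fx _.
exact: (congr1 ( *%R a) fx).
Qed.

Lemma Lspace_normE (f : F) :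
  (Lspace_norm (Lclass f))%:E = ('N[mu]_p[EFin \o f])%E.
Proof.
rewrite -(finite_norm_fine f) /Lspace_norm; congr (fine _)%:E.
apply: ae_eq_Lnorm (Lclass_repr f); exact: measurable_funPT.
Qed.

Lemma LaddA : associative Ladd.
Proof.
move=> u v w; rewrite -(LreprK u) -(LreprK v) -(LreprK w).
by rewrite !LclassD addrA.
Qed.

Lemma LaddC : commutative Ladd.
Proof. by move=> u v; rewrite /Ladd addrC. Qed.

Lemma Ladd0 : left_id (Lclass 0) Ladd.
Proof. by move=> u; rewrite -(LreprK u) LclassD add0r. Qed.

Lemma LaddN : left_inverse (Lclass 0) Lopp Ladd.
Proof. by move=> u; rewrite -(LreprK u) LclassN LclassD addNr. Qed.

HB.instance Definition _ := GRing.isZmodule.Build L LaddA LaddC Ladd0 LaddN.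

Lemma LscaleA a b u : Lscale a (Lscale b u) = Lscale (a * b) u.
Proof. by rewrite -(LreprK u) !LclassZ scalerA. Qed.

Lemma Lscale1 : left_id 1 Lscale.
Proof. by move=> u; rewrite -(LreprK u) LclassZ scale1r. Qed.

Lemma LscaleDr : right_distributive Lscale +%R.
Proof.
move=> a u v; rewrite -(LreprK u) -(LreprK v) [X in Lscale a X]LclassD.
by rewrite !LclassZ scalerDr; exact/esym/LclassD.
Qed.

Lemma LscaleDl u : {morph Lscale^~ u : a b / a + b}.
Proof.
move=> a b; rewrite -(LreprK u) !LclassZ scalerDl.
exact/esym/LclassD.
Qed.

HB.instance Definition _ :=
  GRing.Zmodule_isLmodule.Build R L LscaleA Lscale1 LscaleDr LscaleDl.

Lemma Lspace_normD (u v : L) :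
  Lspace_norm (u + v) <= Lspace_norm u + Lspace_norm v.
Proof.
rewrite -lee_fin EFinD -(LreprK u) -(LreprK v) [X in Lspace_norm X]LclassD.
by rewrite !Lspace_normE eminkowski.
Qed.

Lemma Lspace_normZ a (u : L) : Lspace_norm (a *: u) = `|a| * Lspace_norm u.
Proof.
apply: EFin_inj; rewrite EFinM -(LreprK u) [X in Lspace_norm X]LclassZ.
by rewrite !Lspace_normE LnormZ.
Qed.

Lemma Lspace_norm_eq0 (u : L) : Lspace_norm u = 0 -> u = 0.
Proof.
rewrite -(LreprK u) => u0; apply/Lclass_eqP.
by apply: (@fine_Lnormr_eq0 _ _ _ _ _ p1); rewrite -Lspace_normE u0.
Qed.

HB.instance Definition _ := Lmodule_isNormed.Build R L
  Lspace_normD Lspace_normZ Lspace_norm_eq0.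

End Lspace_normed.

(** Scalars are real throughout. *)
Section Lp_spaces.
Variable R : realType.

Definition unit_interval_measure :
    {measure set (measurableTypeR R) -> \bar R} :=
  mrestr (@lebesgue_measure R) (measurable_itv `]0, 1[).

(** [L_p(0,1)]: the functions live on the whole line, but Lebesgue measure is
    restricted to the interval, so values outside of it are disregarded. *)
Definition Lp01 (p : R) (p1 : (1 <= p%:E)%E) : normedModType R :=
  LspaceType unit_interval_measure p1.

(** [ell_p] as [L_p] of the counting measure: its classes are singletons and
    its norm is [(\sum_n `|u n| `^ p) `^ p^-1], see [Lnorm_counting]. *)
Definition ell (p : R) (p1 : (1 <= p%:E)%E) : normedModType R :=
  LspaceType (@counting nat R) p1.

Definition ell2 : normedModType R := ell (lee1n 2).

Lemma lee1_gt2 (p : R) : 2 < p -> (1 <= p%:E)%E.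
Proof. by move=> p2; rewrite lee_fin (le_trans _ (ltW p2)) // ler1n. Qed.

End Lp_spaces.

Section Operators.
Variable R : realType.
Implicit Types V W X Y : normedModType R.

Definition closed_subspace V (A : set V) : Prop :=
  [/\ closed A, A 0 & forall a x y, A x -> A y -> A (a *: x + y)].

(** [f] restricts to a bounded linear operator on the subspace [A]; its values
    outside of [A] are irrelevant. *)
Definition operator_on V W (A : set V) (f : V -> W) : Prop :=
  (forall a x y, A x -> A y -> f (a *: x + y) = a *: f x + f y) /\
  (exists M : R, forall x, A x -> `|f x| <= M * `|x|).

Definition operator V W (f : V -> W) : Prop := operator_on setT f.

(** [f] restricts to a linear homeomorphism of the subspace [A] onto [B]. *)
Definition isomorphism_on V W (A : set V) (f : V -> W) (B : set W) : Prop :=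
  operator_on A f /\
  exists g : W -> V,
    [/\ operator_on B g,
        forall x, A x -> B (f x) /\ g (f x) = x &
        forall y, B y -> A (g y) /\ f (g y) = y].

Definition isomorphic_to V W (A : set V) : Prop :=
  exists f : V -> W, isomorphism_on A f setT.

Definition ell_strictly_singular (p : R) (p1 : (1 <= p%:E)%E) X Y
    (T : X -> Y) : Prop :=
  ~ exists Z0 : set X,
      [/\ closed_subspace Z0, isomorphic_to (ell p1) Z0 &
          isomorphism_on Z0 T (T @` Z0)].

Definition isometric_embedding X Y (J : X -> Y) : Prop :=
  operator J /\ forall x, `|J x| = `|x|.

Definition factors_through_ell2 X Y (S : X -> Y) : Prop :=
  exists (A : X -> ell2 R) (B : ell2 R -> Y),
    [/\ operator A, operator B & S = B \o A].

(** Only meaningful for bounded operators: [sup] of an unbounded set is 0. *)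
Definition opnorm X Y (f : X -> Y) : R :=
  sup [set `|f x| | x in [set x : X | `|x| <= 1]].

Definition injective_space (Z : completeNormedModType R) : Prop :=
  forall (X : completeNormedModType R) (A : set X) (u : X -> Z),
    closed_subspace A -> operator_on A u ->
    exists v : X -> Z, operator v /\ forall x, A x -> v x = u x.

End Operators.

(* Main.v *)
(** If [T] is [ell_p]-strictly singular on [L_p] with [2 < p], then for every
    [e > 0] there is [M] such that [|T u|_p <= e |u|_p + M |u|_2].  Otherwise
    there are unit vectors [x_n] with [|x_n|_2 -> 0] and [|T x_n|_p >= e]; by
    Kadec-Pelczynski a subsequence is a small perturbation of disjointly
    supported [y_k].  Choosing signs well,
    [\sum_(k < N) |T y_k|_2^2 <= |T (\sum_(k < N) +-y_k)|_2^2 = O(N^(2/p))],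
    so [|T y_k|_2] has lower limit [0], and a second application of
    Kadec-Pelczynski makes [T y_k] almost disjoint as well: [T] is then an
    isomorphism on a copy of [ell_p] spanned by some of the [y_k].

    Haar coefficients turn [|u|_2] into the norm of [A u] for an operator [A]
    from [L_p] to [ell_2].  The space [Z] embeds isometrically into the bounded
    functions on its dual ball, and injectivity gives a bounded left inverse of
    this embedding.  For each [phi] in the dual ball, Hahn-Banach on
    [L_p * ell_2] splits [phi (J (T u))] into a functional of [A u] of norm at
    most [M] and a remainder of size at most [e |u|_p]. *)

Require Import Defs.
From HB Require Import structures.
From mathcomp Require Import all_boot all_order all_algebra.
From mathcomp Require Import all_classical all_reals all_analysis.
From mathcomp Require Import measurable_realfun.
From mathcomp Require Import ring lra.

Set Implicit Arguments.
Unset Strict Implicit.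
Unset Printing Implicit Defensive.

Import Order.TTheory GRing.Theory Num.Theory.
Import numFieldNormedType.Exports.

Local Open Scope classical_set_scope.
Local Open Scope ring_scope.

(** * Hahn-Banach *)

(** The estimate bounds the norm of [J (T u)] but yields no operator on [ell_2] near [J \o T].
    Testing against a single functional makes the problem scalar, where Hahn-Banach loses no
    constant. The splittings obtained for different [phi] need not fit together: a bounded function
    on the dual ball is any family of numbers with a common bound. That freedom is why [Z] is
    embedded into all bounded functions, with no continuity asked of them. The [L_2] norm serves
    twice. Its smallness confines the mass of a unit vector of [L_p] to a set of small measure,
    which starts Kadec-Pelczynski. And by the parallelogram law suitably signed sums are at least as
    large as orthogonal ones, whereas [N] disjoint pieces of norm at most 1 have a sum of [p]-norm
    at most [N^(1/p)]. The two rates coincide at [p = 2]; the contradiction comes from [2 < p]. From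
    the Haar system two inequalities are taken: Bessel, for the boundedness of [A], and
    [|u|_2 <= |A u|], from the almost everywhere convergence of dyadic averages. *)

Section HahnBanach.
Variables (R : realType) (V : lmodType R) (p : V -> R).
Hypothesis pD : forall x y, p (x + y) <= p x + p y.
Hypothesis pZ : forall a x, 0 <= a -> p (a *: x) = a * p x.

(* Partial linear functionals are represented by their graphs. *)
Let lin_graph (G : set (V * R)) :=
  (forall a u v, G u -> G v -> G (a *: u + v)) /\ forall u, G u -> u.2 <= p u.1.

(** Domination makes a linear graph single-valued: the difference of two points over the same [x]
    lies over 0, where [p] vanishes. Using this in both orders gives equality. *)
Let dominated_fun G x r s : lin_graph G -> G (x, r) -> G (x, s) -> r <= s.
Proof.
move=> [Gl Gp] xr xs; have := Gl (-1) _ _ xs xr => /Gp /=.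
rewrite !scaleN1r addNr.
have -> : p 0 = 0 by rewrite -(scale0r 0) pZ // mul0r.
by rewrite addrC subr_le0.
Qed.

(** The value at [x0] has to lie between all [u.2 - p (u.1 - x0)] and all [p (v.1 + x0) - v.2].
    Subadditivity of [p] leaves room for it, and homogeneity reduces the coefficient [t] to 1 and
    -1. *)
Let extend_graph (G : set (V * R)) x0 : lin_graph G -> G 0 ->
  exists c, lin_graph [set u | exists v t, G v /\ u = v + t *: (x0, c)].
Proof.
move=> [Gl Gp] G0.
have key (u v : V * R) : G u -> G v -> u.2 - p (u.1 - x0) <= p (v.1 + x0) - v.2.
  move=> Gu Gv; rewrite lerBlDr addrAC lerBrDr.
  have := Gp _ (Gl 1 _ _ Gu Gv); rewrite /= !scale1r => /le_trans; apply.
  apply: le_trans (pD _ _); rewrite le_eqVlt; apply/orP; left; apply/eqP.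
  by congr p; rewrite addrACA addrN addr0 addrC.
pose E := [set u.2 - p (u.1 - x0) | u in G].
have E0 : E !=set0 by exists (0 - p (0 - x0)), 0.
have ubE v : G v -> ubound E (p (v.1 + x0) - v.2).
  by move=> Gv _ [u Gu <-]; exact: key.
have supE : has_sup E by split=> //; exists (p (0 + x0) - 0); exact: (ubE 0).
exists (sup E); split.
  move=> a _ _ [u1 [t1 [Gu ->]]] [v1 [t2 [Gv ->]]].
  exists (a *: u1 + v1), (a * t1 + t2); split; first exact: Gl.
  by rewrite scalerDl scalerDr -scalerA addrACA.
move=> _ [[x r] [t [Gv ->]]] /=.
case: (ltrgtP t 0) => [t0|t0|->]; last first.
- by rewrite !scale0r !addr0; exact: (Gp _ Gv).
- have Gv' : G (t^-1 *: (x, r)).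
    by have := Gl t^-1 _ _ Gv G0; rewrite addr0.
  have := sup_le_ub E0 (ubE _ Gv') => /= h.
  have -> : x + t *: x0 = t *: (t^-1 *: x + x0).
    by rewrite scalerDr scalerA mulfV ?scale1r // gt_eqF.
  rewrite pZ; last exact: ltW.
  rewrite -ler_pdivrMl //.
  have -> : t^-1 * (r + t *: sup E) = t^-1 * r + sup E.
    by rewrite mulrDr mulKf // gt_eqF.
  by rewrite -lerBrDl.
- have nt0 : 0 < - t by rewrite oppr_gt0.
  have Gv' : G ((- t)^-1 *: (x, r)).
    by have := Gl (- t)^-1 _ _ Gv G0; rewrite addr0.
  have := sup_upper_bound supE => /(_ _ (ex_intro2 _ _ _ Gv' erefl)) /= h.
  have -> : x + t *: x0 = (- t) *: ((- t)^-1 *: x - x0).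
    by rewrite scalerBr scalerA mulfV ?scale1r ?gt_eqF // scaleNr opprK.
  rewrite pZ; last exact: ltW.
  rewrite -ler_pdivrMl //.
  have -> : (- t)^-1 * (r + t *: sup E) = (- t)^-1 * r - sup E.
    by rewrite mulrDr -[t in t *: _]opprK scaleNr mulrN mulKf // gt_eqF.
  by rewrite lerBlDr addrC -lerBlDr.
Qed.

Lemma hahn_banach (A : set V) (f : V -> R) :
  A 0 -> (forall a x y, A x -> A y -> A (a *: x + y)) ->
  (forall a x y, A x -> A y -> f (a *: x + y) = a * f x + f y) ->
  (forall x, A x -> f x <= p x) ->
  exists F : V -> R, [/\ forall a x y, F (a *: x + y) = a * F x + F y,
    forall x, F x <= p x & forall x, A x -> F x = f x].
Proof.
move=> A0 Al fl fp; pose G0 := [set u : V * R | A u.1 /\ u.2 = f u.1].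
have G0l : lin_graph G0.
  split=> [a [x r] [y s] [/= Ax ->] [/= Ay ->]|[x r] [/= Ax ->]]; last exact: fp.
  by split; [exact: Al|rewrite /= fl].
(* Joining [G0] to every candidate makes the empty chain harmless: its union is empty, and [G0]
   alone is a dominated linear graph. *)
have [|M [PM maxM]] := @Zorn_bigcup _ [set G | lin_graph (G0 `|` G)].
  move=> F FP Ftot.
  have common u v : (G0 `|` \bigcup_(X in F) X) u ->
      (G0 `|` \bigcup_(X in F) X) v ->
      exists2 X, X = set0 \/ F X & (G0 `|` X) u /\ (G0 `|` X) v.
    move=> [Gu|[X FX Xu]] [Gv|[Y FY Yv]].
    - by exists set0; [left|split; left].
    - by exists Y; [right|split; [left|right]].
    - by exists X; [right|split; [right|left]].
    - have [XY|YX] := Ftot _ _ FX FY.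
        by exists Y; [right|split; right => //; exact: XY].
      by exists X; [right|split; right => //; exact: YX].
  have Fl X : X = set0 \/ F X -> lin_graph (G0 `|` X).
    by case=> [->|/FP//]; rewrite setU0.
  have sub X u : X = set0 \/ F X -> (G0 `|` X) u ->
      (G0 `|` \bigcup_(X in F) X) u.
    by move=> [->|FX] [|//]; [left|left|right; exists X].
  split=> [a u v /common h /h [X FX [Xu Xv]]|u /[dup] /common h /h [X FX [Xu _]]].
    by apply: (sub X) => //; exact: (Fl _ FX).1.
  exact: (Fl _ FX).2.
set N := G0 `|` M in PM.
have N0 : N 0 by left; split=> //=; have := fl (-1) _ _ A0 A0;
  rewrite scaler0 addr0 mulN1r addNr.
have tot x : exists r, N (x, r).
  apply: contrapT => Nx.
  have [c Ec] := extend_graph x PM N0.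
  set N' := [set u | _] in Ec.
  have NN' : N `<=` N'.
    by move=> u Nu; exists u, 0; rewrite scale0r addr0.
  apply: (maxM N'); last first.
    by rewrite /= (_ : G0 `|` N' = N') //; apply/setUidPr => u Gu; apply: NN'; left.
  split; first by move=> u Mu; apply: NN'; right.
  move=> N'M; apply: Nx; exists c; right; apply: N'M.
  by exists 0, 1; rewrite scale1r add0r.
have [F FN] := choice tot.
exists F; split=> [a x y|x|x Ax].
- have h := PM.1 a _ _ (FN x) (FN y).
  by apply/eqP; rewrite eq_le !(dominated_fun PM (FN _) h, dominated_fun PM h (FN _)).
- exact: PM.2 (FN x).
- have h : N (x, f x) by left.
  by apply/eqP; rewrite eq_le !(dominated_fun PM (FN _) h, dominated_fun PM h (FN _)).
Qed.

End HahnBanach.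

Lemma norming_functional (R : realType) (Z : normedModType R) (z : Z) :
  exists phi : Z -> R, [/\ forall a x y, phi (a *: x + y) = a * phi x + phi y,
    forall x, `|phi x| <= `|x| & phi z = `|z|].
Proof.
pose A := range (fun t : R => t *: z).
have [->|z0] := eqVneq z 0.
  by exists (fun=> 0); split=> [a x y|x|]; rewrite ?normr0 // mulr0 addr0.
have nz : `|z| != 0 by rewrite normr_eq0.
pose f (x : Z) := xget 0 [set t | x = t *: z] * `|z|.
have fE t : f (t *: z) = t * `|z|.
  rewrite /f; congr (_ * _); case: xgetP => [s _ /= h|/(_ t) []//].
  apply/eqP; rewrite -subr_eq0; have : (s - t) *: z == 0 by rewrite scalerBl -h subrr.
  by rewrite scaler_eq0 (negbTE z0) orbF.
have [| | | | | |F [Fl Fp Ff]] := @hahn_banach R Z Num.norm _ _ A f.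
- exact: ler_normD.
- by move=> a x a0; rewrite normrZ ger0_norm.
- by exists 0; rewrite ?scale0r.
- by move=> a _ _ [s _ <-] [s2 _ <-]; exists (a * s + s2); rewrite // scalerDl scalerA.
- move=> a _ _ [s _ <-] [s2 _ <-].
  by rewrite scalerA -scalerDl !fE mulrDl mulrA.
- by move=> _ [s _ <-]; rewrite fE normrZ ler_wpM2r // ler_norm.
exists F; split=> // [x|]; last first.
  by rewrite Ff; [rewrite -[z in f z]scale1r fE mul1r|exists 1; rewrite ?scale1r].
rewrite ler_norml Fp andbT lerNl -(normrN x); apply: le_trans (Fp _).
have F0 : F 0 = 0 by have := Fl (-1) 0 0; rewrite scaler0 addr0 mulN1r addNr.
by have := Fl (-1) x 0; rewrite addr0 scaleN1r F0 addr0 mulN1r => ->.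
Qed.

(** * Bounded functions as a Banach space *)

Section BoundedFunctions.
Variables (R : realType) (G : Type).

Definition bounded_fct : {pred G -> R} :=
  [pred f : G -> R | `[< exists M, forall x, `|f x| <= M >]].

Lemma bounded_fct_submod : submod_closed bounded_fct.
Proof.
split=> [|a f g].
  by apply/asboolP; exists 0 => x; rewrite normr0.
move=> /asboolP [M fM] /asboolP [N gN]; apply/asboolP.
exists (`|a| * M + N) => x; apply: (le_trans (ler_normD _ _)).
by rewrite lerD // normrM ler_wpM2l.
Qed.

HB.instance Definition _ :=
  GRing.isSubmodClosed.Build R (G -> R) bounded_fct bounded_fct_submod.

Record linfty := Linfty {lval :> G -> R; lvalP : lval \in bounded_fct}.
HB.instance Definition _ := [isSub for lval].
HB.instance Definition _ := gen_eqMixin linfty.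
HB.instance Definition _ := gen_choiceMixin linfty.
HB.instance Definition _ := [SubChoice_isSubLmodule of linfty by <:].

Definition linfty_norm (f : linfty) : R := sup [set `|f x| | x in [set: G]].

Lemma linfty_norm_ge (f : linfty) x : `|f x| <= linfty_norm f.
Proof.
apply: sup_upper_bound; last by exists x.
split; first by exists `|f x|, x.
by have /asboolP [M fM] := lvalP f; exists M => _ [y _ <-].
Qed.

(** The premise [0 <= M] covers an empty [G], where the norm is the sup of the empty set, that is
    0. *)
Lemma linfty_norm_le (f : linfty) M :
  0 <= M -> (forall x, `|f x| <= M) -> linfty_norm f <= M.
Proof.
move=> M0 fM; have [[r0 [x0 _ _]]|h] := pselect ([set `|f x| | x in [set: G]] !=set0).
  by apply: sup_le_ub => [|_ [y _ <-]//]; exists `|f x0|, x0.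
by rewrite /linfty_norm sup_out // => -[].
Qed.

Lemma linfty_norm_ge0 f : 0 <= linfty_norm f.
Proof.
have [[_ [x _ _]]|h] := pselect ([set `|f x| | x in [set: G]] !=set0).
  exact: le_trans (linfty_norm_ge f x).
by rewrite /linfty_norm sup_out // => -[].
Qed.

Lemma linfty_normD f g : linfty_norm (f + g) <= linfty_norm f + linfty_norm g.
Proof.
apply: linfty_norm_le => [|x]; first by rewrite addr_ge0 // linfty_norm_ge0.
by apply: (le_trans (ler_normD _ _)); rewrite lerD // linfty_norm_ge.
Qed.

Lemma linfty_normZ a f : linfty_norm (a *: f) = `|a| * linfty_norm f.
Proof.
have le1 b g : linfty_norm (b *: g) <= `|b| * linfty_norm g.
  apply: linfty_norm_le => [|x]; first by rewrite mulr_ge0 // linfty_norm_ge0.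
  by rewrite normrM ler_wpM2l // linfty_norm_ge.
apply/eqP; rewrite eq_le le1 /=.
have [->|a0] := eqVneq a 0; first by rewrite normr0 mul0r linfty_norm_ge0.
rewrite -ler_pdivlMl ?normr_gt0 //.
by have := le1 a^-1 (a *: f); rewrite scalerA mulVf // scale1r normfV.
Qed.

Lemma linfty_norm_eq0 f : linfty_norm f = 0 -> f = 0.
Proof.
move=> f0; apply: val_inj; apply/funext => x.
by apply/eqP; rewrite -normr_eq0 eq_le normr_ge0 andbT -f0 linfty_norm_ge.
Qed.

HB.instance Definition _ := Lmodule_isNormed.Build R linfty
  linfty_normD linfty_normZ linfty_norm_eq0.

(** Pointwise limits exist since the scalars are complete. The Cauchy bound is uniform in [x], so
    comparing through a function [h] chosen separately for each [x] still gives a uniform bound. *)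
Lemma linfty_complete (F : set_system linfty) :
  ProperFilter F -> cauchy F -> cvg F.
Proof.
move=> FF /cauchyP cF.
have {}cF (e : R) : 0 < e ->
    exists f0 : linfty, F [set f : linfty | forall x, `|f0 x - f x| < e].
  move=> /cF [f0 Ff0]; exists f0; apply: filterS Ff0 => f.
  rewrite -ball_normE /= => h x; apply: le_lt_trans h.
  exact: (linfty_norm_ge (f0 - f)).
have cv x : cvg ((fun f : linfty => f x) @ F).
  apply: cauchy_cvg; apply/cauchy_exP => e /cF [f0 Ff0]; exists (f0 x).
  change (F [set f : linfty | ball (f0 x) e (f x)]).
  by apply: filterS Ff0 => f /= /(_ x); rewrite -ball_normE.
pose g x := lim ((fun f : linfty => f x) @ F).
have gF (e : R) : 0 < e -> F [set f : linfty | forall x, `|g x - f x| <= e].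
  move=> e0; have e3 : 0 < e / 3 by rewrite divr_gt0.
  have [f0 Ff0] := cF _ e3; apply: filterS (Ff0) => f /= ff0 x.
  have /cvg_ball /(_ _ e3) gx := cv x.
  have [h [h1 h2]] := @filter_ex _ F _ _ (filterI gx Ff0).
  have {}h2 := h2 x; have {}ff0 := ff0 x.
  move: h1; rewrite -ball_normE /= -/(g x) => h1.
  have -> : g x - f x = (g x - h x) + ((h x - f0 x) + (f0 x - f x)) by ring.
  apply: (le_trans (ler_normD _ _)); have := ler_normD (h x - f0 x) (f0 x - f x).
  rewrite distrC in h2; lra.
have gb : g \in bounded_fct.
  have [f fg] := @filter_ex _ F _ _ (gF _ ltr01).
  have /asboolP [M fM] := lvalP f; apply/asboolP; exists (1 + M) => x.
  rewrite -(subrK (f x) (g x)); apply: (le_trans (ler_normD _ _)).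
  by rewrite lerD.
apply/cvg_ex; exists (Linfty gb); apply/fcvg_ballP => e e0.
have e2 : 0 < e / 2 by rewrite divr_gt0.
apply: filterS (gF _ e2) => f h; rewrite -ball_normE /=.
apply: (@le_lt_trans _ _ (e / 2)); last by rewrite ltr_pdivrMr // ltr_pMr // ltr1n.
by apply: linfty_norm_le => //; exact: ltW.
Qed.

HB.instance Definition _ := Uniform_isComplete.Build linfty linfty_complete.

End BoundedFunctions.

Lemma ler_powR_inv (R : realType) (p a b : R) : 0 < p -> 0 <= a -> 0 <= b ->
  a `^ p <= b `^ p -> a <= b.
Proof.
move=> p0 a0 b0; apply: contraTT; rewrite -!ltNge => h.
by rewrite gt0_ltr_powR ?nnegrE.
Qed.

(** * Functions in [L_p] and their restrictions *)

Section LspaceFunctions.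
Context d (T : measurableType d) (R : realType) (mu : {measure set T -> \bar R}).
Variables (p : R) (p1 : (1 <= p%:E)%E).
Local Notation L := (LspaceType mu p1).
Implicit Types (u v : L) (f g : T -> R) (E : set T).

Let p_ge1 : 1 <= p. Proof. by move: p1; rewrite lee_fin. Qed.
Let p_gt0 : 0 < p. Proof. exact: lt_le_trans p_ge1. Qed.

(** The default 0 keeps [toL] total, so that restricted and glued functions can be named before
    their integrability is proved. *)
Definition toL f : L :=
  if pselect (f \in Lfun mu p%:E) is left h then Lclass (Lfun_Sub p1 h) else 0.

Lemma toLE f : f \in Lfun mu p%:E -> toL f = f %[ae mu].
Proof. by rewrite /toL; case: pselect => // h _; exact: Lclass_repr. Qed.

Lemma L_ext u v : u = v %[ae mu] -> u = v.
Proof. by move=> uv; rewrite -(LreprK u) -(LreprK v); apply/Lclass_eqP. Qed.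

Lemma memLfun u : (u : T -> R) \in Lfun mu p%:E.
Proof. exact: Lrepr_subproof. Qed.

Lemma measurable_L u : measurable_fun setT (u : T -> R).
Proof. by have := memLfun u; rewrite inE => /andP[]; rewrite inE. Qed.

Lemma addLE u v : u + v = (fun x => u x + v x) %[ae mu].
Proof. exact: (Lclass_repr (Lrepr u + Lrepr v)). Qed.

Lemma scaleLE a u : a *: u = (fun x => a * u x) %[ae mu].
Proof. exact: (Lclass_repr (a *: Lrepr u)). Qed.

Lemma zeroLE : (0 : L) = (fun=> 0) %[ae mu].
Proof. exact: (Lclass_repr (0 : LfunType mu p1)). Qed.

Lemma normL_powR u : ((`|u| `^ p)%:E = \int[mu]_x (`|u x| `^ p)%:E)%E.
Proof.
rewrite -poweR_EFin; have -> : `|u|%:E = ('N[mu]_p%:E[EFin \o u])%E.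
  rewrite -[u]LreprK -[RHS](@finite_norm_fine _ _ _ _ _ p1 (Lrepr (Lclass (Lrepr u)))).
  by [].
by rewrite powR_Lnorm ?gt_eqF.
Qed.

Lemma Lfun_powR f : measurable_fun setT f ->
  (\int[mu]_x (`|f x| `^ p)%:E < +oo)%E -> f \in Lfun mu p%:E.
Proof.
move=> mf If; rewrite inE; apply/andP; split; rewrite inE //=.
rewrite /finite_norm unlock /Lnorm.
by rewrite poweR_lty.
Qed.

Lemma measurable_powL (D : set T) f : measurable D -> measurable_fun D f ->
  measurable_fun D (fun x => (`|f x| `^ p)%:E).
Proof.
move=> mD mf; apply/measurable_EFinP; apply: (measurableT_comp (measurable_powR p)) => //.
exact: measurableT_comp.
Qed.

Lemma normL_ae u f : measurable_fun setT f -> u = f %[ae mu] ->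
  ((`|u| `^ p)%:E = \int[mu]_x (`|f x| `^ p)%:E)%E.
Proof.
move=> mf uf; rewrite normL_powR; apply: ge0_ae_eq_integral => //.
- exact: measurable_powL (measurable_L u).
- exact: measurable_powL.
- by move: uf; apply: filterS => x /= h xT; rewrite (h xT).
Qed.

Lemma integral_powL_lty u E : measurable E ->
  (\int[mu]_(x in E) (`|u x| `^ p)%:E < +oo)%E.
Proof.
move=> mE; apply: (@le_lt_trans _ _ (\int[mu]_x (`|u x| `^ p)%:E)%E).
  by apply: ge0_subset_integral => //; exact: measurable_powL (measurable_L u).
by rewrite -normL_powR ltry.
Qed.

Definition restr E u : L := toL (fun x => u x * \1_E x).

Lemma integral_powL_indic E f :
  (\int[mu]_x (`|f x * \1_E x| `^ p)%:E = \int[mu]_(x in E) (`|f x| `^ p)%:E)%E.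
Proof.
rewrite [RHS]integral_mkcond; congr integral; apply/funext => x.
rewrite patchE indicE; case: (x \in E); rewrite ?mulr1 //.
by rewrite mulr0 normr0 powR0 ?gt_eqF.
Qed.

Lemma restrE E u : measurable E ->
  restr E u = (fun x => u x * \1_E x) %[ae mu].
Proof.
move=> mE; apply: toLE; apply: Lfun_powR.
  by apply: measurable_funM => //; exact: measurable_L.
by rewrite integral_powL_indic integral_powL_lty.
Qed.

Lemma norm_restr E u : measurable E ->
  ((`|restr E u| `^ p)%:E = \int[mu]_(x in E) (`|u x| `^ p)%:E)%E.
Proof.
move=> mE; rewrite (normL_ae _ (restrE u mE)); last first.
  by apply: measurable_funM => //; exact: measurable_L.
exact: integral_powL_indic.
Qed.

Lemma restr_lin E a u v : measurable E ->
  restr E (a *: u + v) = a *: restr E u + restr E v.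
Proof.
move=> mE; apply: L_ext.
have h1 := restrE (a *: u + v) mE; have h2 := addLE (a *: u) v.
have h3 := addLE (a *: restr E u) (restr E v).
have h4 := scaleLE a u; have h5 := scaleLE a (restr E u).
have h6 := restrE u mE; have h7 := restrE v mE.
near=> x => _; rewrite (near h1 x _ I) // (near h2 x _ I) // (near h3 x _ I) //.
rewrite (near h4 x _ I) // (near h5 x _ I) // (near h6 x _ I) // (near h7 x _ I) //.
by rewrite mulrDl mulrA.
Unshelve. all: by end_near. Qed.

Lemma restrD E u v : measurable E -> restr E (u + v) = restr E u + restr E v.
Proof. by move=> mE; rewrite -[u in LHS]scale1r restr_lin // scale1r. Qed.

Lemma restr0 E : measurable E -> restr E (0 : L) = 0.
Proof. by move=> mE; apply: (addrI (restr E (0 : L))); rewrite -restrD // !addr0. Qed.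

Lemma restrZ E a u : measurable E -> restr E (a *: u) = a *: restr E u.
Proof. by move=> mE; rewrite -[X in restr E X]addr0 restr_lin // restr0 // addr0. Qed.

Lemma restrB E u v : measurable E -> restr E (u - v) = restr E u - restr E v.
Proof. by move=> mE; rewrite -scaleN1r restrD // restrZ // scaleN1r. Qed.

Lemma restr_restr A B u : measurable A -> measurable B ->
  restr A (restr B u) = restr (A `&` B) u.
Proof.
move=> mA mB; apply: L_ext.
have h1 := restrE (restr B u) mA; have h2 := restrE u mB.
have h3 := restrE u (measurableI _ _ mA mB).
near=> x => _; rewrite (near h1 x _ I) // (near h2 x _ I) // (near h3 x _ I) //.
by rewrite indicI /= -mulrA [X in _ * X]mulrC.
Unshelve. all: by end_near. Qed.

Lemma restrT u : restr setT u = u.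
Proof.
apply: L_ext; have h := restrE u measurableT.
by near=> x => _; rewrite (near h x _ I) // indicT mulr1.
Unshelve. all: by end_near. Qed.

Lemma restr_set0 u : restr set0 u = 0.
Proof.
apply: L_ext; have h := restrE u measurable0; have h0 := zeroLE.
by near=> x => _; rewrite (near h x _ I) // (near h0 x _ I) // indic0 mulr0.
Unshelve. all: by end_near. Qed.

Lemma restrU A B u : measurable A -> measurable B -> A `&` B = set0 ->
  restr (A `|` B) u = restr A u + restr B u.
Proof.
move=> mA mB AB0; apply: L_ext.
have h1 := restrE u (measurableU _ _ mA mB); have h2 := restrE u mB.
have h3 := restrE u mA; have h4 := addLE (restr A u) (restr B u).
near=> x => _; rewrite (near h1 x _ I) // (near h4 x _ I) // (near h3 x _ I) //.
rewrite (near h2 x _ I) // -mulrDr; congr (_ * _); rewrite !indicE in_setU.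
case: (boolP (x \in A)); case: (boolP (x \in B)) => /=; rewrite ?addr0 ?add0r //.
move=> /set_mem Bx /set_mem Ax; have : (A `&` B) x by split.
by rewrite AB0.
Unshelve. all: by end_near. Qed.

Lemma normL_powR_le u v : (`|u| <= `|v|) = (`|u| `^ p <= `|v| `^ p).
Proof.
apply/idP/idP => [h|]; first by rewrite ge0_ler_powR ?nnegrE // ltW.
exact: ler_powR_inv.
Qed.

Lemma norm_restr_mono A B u : measurable A -> measurable B -> A `<=` B ->
  `|restr A u| <= `|restr B u|.
Proof.
move=> mA mB AB; rewrite normL_powR_le -lee_fin !norm_restr //.
apply: ge0_subset_integral => //.
by apply: measurable_powL => //; exact: measurable_funS (measurable_L u).
Qed.

Lemma norm_restr_le A u : measurable A -> `|restr A u| <= `|u|.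
Proof. by move=> mA; rewrite -[u in leRHS]restrT norm_restr_mono. Qed.

Lemma norm_restrU A B u : measurable A -> measurable B ->
  `|restr (A `|` B) u| <= `|restr A u| + `|restr B u|.
Proof.
move=> mA mB; have mBA : measurable (B `\` A) by exact: measurableD.
have -> : A `|` B = A `|` (B `\` A) by rewrite setDE setUIr setUv setIT.
rewrite restrU ?setIDAC ?setDv ?set0D //; last by rewrite setDE setIC -setIA setICl setI0.
by apply: (le_trans (ler_normD _ _)); rewrite lerD2l norm_restr_mono //; exact: subDsetl.
Qed.

Lemma restrC_sub A u : measurable A -> u - restr A u = restr (~` A) u.
Proof.
move=> mA; have {1}-> : u = restr A u + restr (~` A) u.
  by rewrite -restrU ?setICr // ?setUv ?restrT //; exact: measurableC.
by rewrite addrAC subrr add0r.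
Qed.

Lemma norm_split A u : measurable A ->
  `|u| `^ p = `|restr A u| `^ p + `|restr (~` A) u| `^ p.
Proof.
move=> mA; have mC := measurableC mA; apply: EFin_inj; rewrite EFinD.
rewrite !norm_restr // normL_powR -(setUv A) ge0_integral_setU //.
- by rewrite setUv; exact: measurable_powL (measurable_L u).
- exact/disj_setPCl.
Qed.

Lemma norm_disjD A B u v : measurable A -> measurable B -> A `&` B = set0 ->
  restr A u = u -> restr B v = v ->
  `|u + v| `^ p = `|u| `^ p + `|v| `^ p.
Proof.
move=> mA mB AB uA vB; have mC := measurableC mA.
have Av : restr A v = 0 by rewrite -vB restr_restr // AB restr_set0.
have Cu : restr (~` A) u = 0 by rewrite -uA restr_restr // setICl restr_set0.
have Cv : restr (~` A) v = v.
  rewrite -vB restr_restr // (_ : ~` A `&` B = B) ?vB //.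
  by apply/setIidPr/disjoints_subset; rewrite setIC.
by rewrite (norm_split _ mA) !restrD // uA Av Cu Cv addr0 add0r.
Qed.

End LspaceFunctions.

(** * Kadec-Pelczynski *)

Section SecondMoment.
Context d (T : measurableType d) (R : realType) (mu : {measure set T -> \bar R}).
Variables (p : R) (p1 : (1 <= p%:E)%E).
Hypotheses (p2 : 2 <= p) (mu1 : (mu setT <= 1)%E).
Local Notation L := (LspaceType mu p1).
Implicit Types (u v : L) (E : set T).

(** The squared [L_2] norm. A real integral would be 0 by default if it were infinite;
    [sq_integrable] excludes this. *)
Definition sq u : R := \int[mu]_x (u x ^+ 2).

Lemma sq_ge0 u : 0 <= sq u.
Proof. by apply: Rintegral_ge0 => x _; rewrite sqr_ge0. Qed.

Let muT_fin : mu setT \is a fin_num.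
Proof. by rewrite ge0_fin_numE //; exact: le_lt_trans mu1 (ltry _). Qed.

Lemma Lfun2_L u : (u : T -> R) \in Lfun mu 2%:E.
Proof.
apply: (@Lfun_subset _ _ _ _ 2%:E p%:E _ _ _ _ u) => //; first exact: lee1n.
exact: memLfun.
Qed.

Lemma sq_integrable u : mu.-integrable setT (EFin \o (fun x => u x ^+ 2)).
Proof. exact: Lfun2_integrable_sqr (Lfun2_L u). Qed.

Lemma sq_ae u (f : T -> R) : measurable_fun setT f -> u = f %[ae mu] ->
  sq u = \int[mu]_x (f x ^+ 2).
Proof.
move=> mf uf; rewrite /sq /Rintegral; congr fine; apply: ge0_ae_eq_integral => //.
- by apply/measurable_EFinP/measurable_funX; exact: measurable_L.
- by apply/measurable_EFinP/measurable_funX.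
- by move=> x _; rewrite lee_fin sqr_ge0.
- by move=> x _; rewrite lee_fin sqr_ge0.
- by move: uf; apply: filterS => x /= h xT; rewrite (h xT).
Qed.

Lemma sqZ a u : sq (a *: u) = a ^+ 2 * sq u.
Proof.
rewrite (sq_ae _ (scaleLE a u)); last first.
  by apply: measurable_funM => //; exact: measurable_L.
rewrite /sq -RintegralZl //; last exact: sq_integrable.
by apply: eq_Rintegral => x _; rewrite exprMn.
Qed.

Lemma sq_parallelogram u v : sq (u + v) + sq (u - v) = 2 * (sq u + sq v).
Proof.
have uv : u - v = (fun x => u x - v x) %[ae mu].
  have h1 := addLE u (- v); have h2 := scaleLE (-1) v.
  near=> x => _; rewrite (near h1 x _ I) // -scaleN1r (near h2 x _ I) //.
  by rewrite mulN1r.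
have mu' : measurable_fun setT (u : T -> R) by exact: measurable_L.
have mv : measurable_fun setT (v : T -> R) by exact: measurable_L.
rewrite (sq_ae _ uv); last exact: measurable_funB.
rewrite (sq_ae _ (addLE u v)); last exact: measurable_funD.
have [_ LD] := @Lfun_addr_closed _ _ _ mu 2%:E (lee1n 2).
have LN := @Lfun_oppr_closed _ _ _ mu 2%:E.
have iD : mu.-integrable setT (EFin \o (fun x => (u x + v x) ^+ 2)).
  apply: (@Lfun2_integrable_sqr _ _ _ mu (fun x => u x + v x)).
  exact: (LD (u : T -> R) v (Lfun2_L u) (Lfun2_L v)).
have iB : mu.-integrable setT (EFin \o (fun x => (u x - v x) ^+ 2)).
  apply: (@Lfun2_integrable_sqr _ _ _ mu (fun x => u x - v x)).
  exact: (LD (u : T -> R) (\- v) (Lfun2_L u) (LN v (Lfun2_L v))).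
rewrite -RintegralD // mulrDr /sq -!RintegralZl //; try exact: sq_integrable.
rewrite -RintegralD //; last 2 first.
- exact: (integrableZl measurableT 2 (sq_integrable u)).
- exact: (integrableZl measurableT 2 (sq_integrable v)).
by apply: eq_Rintegral => x _; ring.
Unshelve. all: by end_near. Qed.

Lemma sqr_le_powR (x : R) : x ^+ 2 <= 1 + `|x| `^ p.
Proof.
have [x1|x1] := leP `|x| 1.
  rewrite -real_normK ?num_real //; apply: (@le_trans _ _ 1).
    by rewrite expr_le1.
  by rewrite lerDl powR_ge0.
rewrite -real_normK ?num_real // -powR_mulrn //.
by apply: (@le_trans _ _ (`|x| `^ p)); [apply: ler_powR => //; exact: ltW|rewrite lerDr].
Qed.

Lemma powR_le_sqr (x : R) : `|x| <= 1 -> `|x| `^ p <= x ^+ 2.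
Proof.
move=> x1; rewrite -real_normK ?num_real // -powR_mulrn //.
have [->|x0] := eqVneq x 0; first by rewrite normr0 !powR0 // gt_eqF // (lt_le_trans _ p2).
by apply: ger_powR => //; rewrite normr_gt0 x0.
Qed.

Lemma powR_integrable u : mu.-integrable setT (EFin \o (fun x => `|u x| `^ p)).
Proof.
apply/integrableP; split.
  by have := @measurable_powL _ T R p setT u measurableT (measurable_L u).
under eq_integral do rewrite /= ger0_norm ?powR_ge0 //.
exact: integral_powL_lty.
Qed.

Lemma norm_restr_powR u E : measurable E ->
  `|restr E u| `^ p = \int[mu]_(x in E) (`|u x| `^ p).
Proof. by move=> mE; rewrite /Rintegral -norm_restr. Qed.

(** A crude substitute for the inclusion of [L_p] in [L_2]: integrating [x ^+ 2 <= 1 + |x| ^ p] for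
    a unit vector gives [1 + 1], and homogeneity does the rest. *)
Lemma sq_le_norm u : sq u <= 2 * `|u| ^+ 2.
Proof.
have le2 v : `|v| = 1 -> sq v <= 2.
  move=> v1; have i1 : mu.-integrable setT (EFin \o (fun=> 1 : R)).
    apply/integrableP; split; first exact: measurable_cst.
    under eq_integral do rewrite /= normr1.
    by rewrite integral_cst // mul1e (le_lt_trans mu1) ?ltry.
  apply: (@le_trans _ _ (\int[mu]_x (1 + `|v x| `^ p))).
    apply: le_Rintegral => //; first exact: sq_integrable.
      exact: (integrableD measurableT i1 (powR_integrable v)).
    by move=> x _; exact: sqr_le_powR.
  rewrite RintegralD //; last exact: powR_integrable.
  have := @norm_restr_powR v setT measurableT; rewrite restrT v1 powR1 => <-.
  rewrite lerD2r Rintegral_cst // mul1r.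
  by rewrite -lee_fin fineK.
have [->|u0] := eqVneq u 0.
  by rewrite -(scale0r 0) sqZ expr0n mul0r mulr_ge0 // sqr_ge0.
have nu : `|u| != 0 by rewrite normr_eq0.
have -> : sq u = `|u| ^+ 2 * sq (`|u|^-1 *: u).
  by rewrite -sqZ scalerA mulfV // scale1r.
by rewrite mulrC ler_wpM2r ?sqr_ge0 // le2 // normrZ normfV normr_id mulVf.
Qed.

(** Absolute continuity of the integral of [|u| ^ p]. *)
Lemma restr_small u (e : R) : 0 < e -> exists2 r : R, 0 < r &
  forall E, measurable E -> (mu E < r%:E)%E -> `|restr E u| < e.
Proof.
move=> e0; have ep : 0 < e `^ p by rewrite powR_gt0.
have [r [r0 h]] := integral_normr_continuous (powR_integrable u) ep.
exists r => // E mE /(h _ mE); under eq_Rintegral do rewrite ger0_norm ?powR_ge0 //.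
rewrite -norm_restr_powR //; apply: contraTT; rewrite -!leNgt => h'.
by rewrite ge0_ler_powR ?nnegrE // ltW // (lt_le_trans _ p2).
Qed.

(** At the threshold 1 the powers change order: above it [u ^+ 2 >= 1], so the set has measure at
    most [sq u] ([mu_large]); below it [|u| ^ p <= u ^+ 2], so little norm remains off the set
    ([norm_restr_small]). *)
Definition large u : set T := [set x | 1 < `|u x|].

Lemma measurable_large u : measurable (large u).
Proof.
have mf : measurable_fun setT (fun x => `|u x|).
  by apply: measurableT_comp => //; exact: measurable_L.
have := mf measurableT _ (measurable_itv `]1, +oo[).
rewrite setTI (_ : _ @^-1` _ = large u) //.
by apply/seteqP; split=> x; rewrite /large /= in_itv /= andbT.
Qed.

Lemma mu_large u : (mu (large u) <= (sq u)%:E)%E.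
Proof.
have mF := measurable_large u.
rewrite /sq /Rintegral fineK; last exact: integrable_fin_num (sq_integrable u).
have -> : mu (large u) = (\int[mu]_(x in large u) 1%:E)%E by rewrite integral_cst // mul1e.
have msq : measurable_fun setT (fun x => (u x ^+ 2)%:E).
  by apply/measurable_EFinP/measurable_funX; exact: measurable_L.
apply: (@le_trans _ _ (\int[mu]_(x in large u) (u x ^+ 2)%:E)%E).
  apply: ge0_le_integral => //.
  - exact: measurable_funS msq.
  - move=> x /ltW x1; rewrite lee_fin -real_normK ?num_real //.
    by rewrite exprn_ege1.
by apply: ge0_subset_integral => // x _; rewrite lee_fin sqr_ge0.
Qed.

Lemma norm_restr_small u : `|restr (~` large u) u| `^ p <= sq u.
Proof.
have mF := measurableC (measurable_large u).
rewrite norm_restr_powR // -lee_fin /sq /Rintegral !fineK; last 2 first.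
- exact: integrable_fin_num (sq_integrable u).
- by apply: integrable_fin_num => //; apply: integrableS (powR_integrable u).
have msq : measurable_fun setT (fun x => (u x ^+ 2)%:E).
  by apply/measurable_EFinP/measurable_funX; exact: measurable_L.
apply: (@le_trans _ _ (\int[mu]_(x in ~` large u) (u x ^+ 2)%:E)%E).
  apply: ge0_le_integral => //.
  - by apply: measurable_powL => //; exact: measurable_funS (measurable_L u).
  - exact: measurable_funS msq.
  - by move=> x /negP; rewrite -leNgt lee_fin; exact: powR_le_sqr.
by apply: ge0_subset_integral => // x _; rewrite lee_fin sqr_ge0.
Qed.

End SecondMoment.

Section KadecPelczynski.
Context d (T : measurableType d) (R : realType) (mu : {measure set T -> \bar R}).
Variables (p : R) (p1 : (1 <= p%:E)%E).
Hypotheses (p2 : 2 <= p) (mu1 : (mu setT <= 1)%E).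
Local Notation L := (LspaceType mu p1).

(** A gliding hump. Each chosen vector is nearly carried by its set [F (n_ k)]. Later sets are so
    small that, by absolute continuity, removing all of them from [F (n_ k)] costs little; the
    removal makes the sets disjoint. Each of the two errors is allowed half of [dl k]. *)
Lemma kadec_pelczynski (x : nat -> L) (dl : nat -> R) :
  (forall N e, 0 < e -> exists2 n, (N <= n)%N & sq (x n) < e) ->
  (forall k, 0 < dl k) ->
  exists (n_ : nat -> nat) (E : nat -> set T),
    [/\ {homo n_ : i j / (i < j)%N}, forall k, measurable (E k),
        trivIset setT E &
        forall k, `|x (n_ k) - restr (E k) (x (n_ k))| <= dl k].
Proof.
move=> hx dl0; pose F n := large (x n).
have mF n : measurable (F n) by exact: measurable_large.
(* A state [(k, n, t)]: the [k]-th selected index is [n], and the sets removed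
   later from the support of [x n] have total measure less than [t]. *)
pose good (s : nat * nat * R) := [/\ 0 < s.2,
  forall E, measurable E -> (mu E < (s.2)%:E)%E -> `|restr E (x s.1.2)| <= dl s.1.1 / 2 &
  `|restr (~` F s.1.2) (x s.1.2)| <= dl s.1.1 / 2].
have next k N (t : R) : 0 < t -> exists n t', [/\ (N <= n)%N, good (k, n, t'),
    (mu (F n) <= (t / 4)%:E)%E & t' <= t / 2].
  move=> t0; have dk : 0 < dl k / 2 by rewrite divr_gt0.
  (* The first term controls the measure of [F n], the second the norm of [x n] off [F n]. *)
  have e0 : 0 < Num.min (t / 4) ((dl k / 2) `^ p).
    by rewrite lt_min divr_gt0 //= powR_gt0.
  have [n Nn] := hx N _ e0; rewrite lt_min => /andP[s1 s2].
  have [r r0 hr] := restr_small p2 (x n) dk.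
  (* Staying below [r] makes the removal from [x n] cheap; halving [t] makes the budgets decay
     geometrically. *)
  exists n, (Num.min r (t / 2)); split=> //.
  - split=> /=; first by rewrite lt_min r0 divr_gt0.
      move=> E mE; rewrite EFin_min lt_min => /andP[h _].
      by apply/ltW/hr.
    rewrite leNgt; apply/negP => h.
    have := lt_le_trans s2 (ltW (_ : _ < `|restr (~` F n) (x n)| `^ p)).
    move=> /(_ (gt0_ltr_powR _ _ _ h)); rewrite !nnegrE ltW //.
    move=> /(_ (lt_le_trans _ p2)) h'.
    have := norm_restr_small p2 mu1 (x n); rewrite leNgt h' //.
  - by apply: le_trans (mu_large p2 mu1 (x n)) _; rewrite lee_fin ltW.
  - by rewrite ge_min lexx orbT.
(* Dependent choice asks for a successor of every state; the premise [good s] makes the relation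
   vacuous at the others. *)
pose step (s s' : nat * nat * R) := good s -> [/\ good s', s'.1.1 = s.1.1.+1,
  (s.1.2 < s'.1.2)%N, (mu (F s'.1.2) <= (s.2 / 4)%:E)%E & s'.2 <= s.2 / 2].
have [n0 [t0 [_ good0 _ _]]] := next 0%N 0%N 1 ltr01.
have [|f [f0 fS]] := @dependent_choice _ step _ (0%N, n0, t0).
  move=> [[k n] t]; apply: cid; have [gs|ngs] := pselect (good (k, n, t)); last first.
    by exists (k, n, t).
  have [|n' [t' [h1 h2 h3 h4]]] := next k.+1 n.+1 t; first by case: gs.
  by exists (k.+1, n', t').
have gf n : good (f n) by elim: n => [|n /fS[]//]; rewrite f0.
have {}fS n := fS n (gf n).
have fk n : (f n).1.1 = n by elim: n => [|n IH]; [rewrite f0|case: (fS n) => _ ->; rewrite IH].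
pose n_ k := (f k).1.2; pose t_ k := (f k).2.
have t_gt0 k : 0 < t_ k by case: (gf k).
have t_geo k i : t_ (k + i)%N <= t_ k / (2 ^ i)%:R.
  elim: i => [|i IH]; first by rewrite addn0 expn0 divr1.
  rewrite addnS; case: (fS (k + i)%N) => _ _ _ _ /le_trans; apply.
  by rewrite expnSr natrM invfM mulrA ler_wpM2r // invr_ge0.
have n_inc : {homo n_ : i j / (i < j)%N}.
  by apply: homo_ltn => [|n]; [exact: ltn_trans|case: (fS n)].
pose U k := \bigcup_i F (n_ (k + i).+1).
have mU k : measurable (U k) by apply: bigcup_measurable => i _; exact: mF.
pose E k := F (n_ k) `\` U k.
have mE k : measurable (E k) by exact: measurableD.
have muU k : (mu (U k) < (t_ k)%:E)%E.
  apply: (@le_lt_trans _ _ (t_ k / 2)%:E); last first.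
    by rewrite lte_fin ltr_pdivrMr // ltr_pMr // ltr1n.
  (* By [t_geo] the [i]-th removed set has measure at most [t_ k / 2] divided by [2 ^ i.+1], and
     these bounds add up to [t_ k / 2]. *)
  apply: (@le_trans _ _ (\sum_(i <oo) mu (F (n_ (k + i).+1)))%E).
    by apply: measure_sigma_subadditive.
  have t2 : 0 <= t_ k / 2 by rewrite divr_ge0 // ltW.
  apply: le_trans (epsilon_trick0 xpredT t2).
  apply: lee_nneseries => // i _; case: (fS (k + i)%N) => _ _ _ h _.
  apply: (le_trans h); rewrite lee_fin.
  have := t_geo k i; rewrite expnS natrM invfM /t_.
  by move: (_ ^-1) => c; lra.
exists n_, E; split=> //.
- apply: ltn_trivIset => i j ji; apply/seteqP; split=> // y [[_ Uj] [Fi _]].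
  apply: Uj; exists (i - j.+1)%N => //.
  have -> : ((j + (i - j.+1)).+1 = i)%N by rewrite -addSn subnKC.
  exact: Fi.
- move=> k; rewrite restrC_sub //.
  rewrite /E setDE setCI setCK; apply: (le_trans (norm_restrU _ _ _)) => //.
    exact: measurableC.
  have [_ h1 h2] := gf k; rewrite -/(n_ k) fk in h1 h2.
  by have := lerD h2 (h1 _ (mU k) (muU k)); rewrite -splitr.
Qed.

End KadecPelczynski.

(** * Disjoint sequences and copies of [ell_p] *)

Section DisjointSequences.
Context d (T : measurableType d) (R : realType) (mu : {measure set T -> \bar R}).
Variables (p : R) (p1 : (1 <= p%:E)%E).
Local Notation L := (LspaceType mu p1).
Implicit Types (u v : L) (E : set T).

Let p_gt0 : 0 < p.
Proof. by apply: lt_le_trans (_ : 0 < 1) _ => //; rewrite -lee_fin. Qed.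

Lemma restr_sum E n (y : nat -> L) : measurable E ->
  restr E (\sum_(k < n) y k) = \sum_(k < n) restr E (y k).
Proof.
move=> mE; elim: n => [|n IH]; first by rewrite !big_ord0 restr0.
by rewrite !big_ord_recr /= restrD // IH.
Qed.

Lemma norm_disj_sum (E : nat -> set T) (y : nat -> L) n :
  (forall k, measurable (E k)) -> trivIset setT E ->
  (forall k, restr (E k) (y k) = y k) ->
  `|\sum_(k < n) y k| `^ p = \sum_(k < n) `|y k| `^ p.
Proof.
move=> mE tE yE; elim: n => [|n IH].
  by rewrite !big_ord0 normr0 powR0 // gt_eqF.
have mU : measurable (\big[setU/set0]_(k < n) E k) by exact: bigsetU_measurable.
rewrite !big_ord_recr /= (@norm_disjD _ _ _ _ _ _ (\big[setU/set0]_(k < n) E k) (E n)) ?IH //.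
  rewrite big_distrl /= big1 // => k _.
  by have /trivIsetP := tE; apply => //; rewrite neq_ltn ltn_ord.
rewrite restr_sum //; apply: eq_bigr => k _.
rewrite -[in LHS]yE restr_restr // (_ : _ `&` _ = E k) ?yE //.
apply/setIidPr; rewrite -bigcup_mkord => x Ekx.
by exists k => //=; exact: ltn_ord.
Qed.

Section Decomposition.
Variable E : nat -> set T.
Hypotheses (mE : forall k, measurable (E k)) (tE : trivIset setT E).
Let mU : measurable (\bigcup_k E k). Proof. exact: bigcup_measurable. Qed.
Let mUc : measurable (~` \bigcup_k E k). Proof. exact: measurableC. Qed.

Lemma norm_series u : ((`|u| `^ p)%:E = \sum_(k <oo) (`|restr (E k) u| `^ p)%:E +
  (`|restr (~` \bigcup_k E k) u| `^ p)%:E)%E.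
Proof.
rewrite (norm_split u mU) EFinD; congr (_ + _)%E.
rewrite norm_restr // ge0_integral_bigcup //.
  by apply: eq_eseriesr => k _; rewrite norm_restr.
by apply: measurable_powL => //; exact: measurable_funS (measurable_L u).
Qed.

Lemma restr_ext u v : (forall k, restr (E k) u = restr (E k) v) ->
  restr (~` \bigcup_k E k) u = restr (~` \bigcup_k E k) v -> u = v.
Proof.
move=> h1 h2; apply/eqP; rewrite -subr_eq0 -normr_eq0; apply/eqP.
have : ((`|u - v| `^ p)%:E = 0)%E.
  rewrite norm_series restrB // h2 subrr normr0 powR0 ?gt_eqF // adde0.
  by rewrite eseries0 // => k _ _; rewrite restrB // h1 subrr normr0 powR0 ?gt_eqF.
by move=> h; apply: (@powR_eq0_eq0 _ _ p); exact: EFin_inj h.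
Qed.

Lemma restr_glue (f : T -> R) : measurable_fun setT f ->
  f \in Lfun mu p%:E -> forall F, measurable F -> forall u,
  (forall x, F x -> f x = u x) -> restr F (toL mu p1 f) = restr F u.
Proof.
move=> mf Lf F mF u fu; apply: L_ext.
have h1 := restrE (toL mu p1 f) mF; have h2 := restrE u mF; have h3 := toLE p1 Lf.
near=> x => _; rewrite (near h1 x _ I) // (near h2 x _ I) // (near h3 x _ I) //.
rewrite indicE; have [/set_mem Fx|] := boolP (x \in F); last by rewrite !mulr0.
by rewrite fu.
Unshelve. all: by end_near. Qed.

(** An infinite disjoint sum is defined pointwise instead of as a limit of partial sums:
    measurability is checked on each [E k], and integrability follows from countable additivity. *)
Lemma glue (v : nat -> L) : (\sum_(k <oo) (`|restr (E k) (v k)| `^ p)%:E < +oo)%E ->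
  exists u, (forall k, restr (E k) u = restr (E k) (v k)) /\
    restr (~` \bigcup_k E k) u = 0.
Proof.
(* Off the union of the sets, [idx] takes its default value 0; the indicator in [f] erases what this
   would contribute. *)
move=> sv; pose idx x := xget 0%N [set k | E k x].
have idxE k x : E k x -> idx x = k.
  move=> Ekx; rewrite /idx; case: xgetP => [j _ /= Ejx|/(_ k)//].
  by apply: tE => //; exists x.
pose f x := v (idx x) x * \1_(\bigcup_k E k) x.
have fE k x : E k x -> f x = v k x.
  move=> Ekx; rewrite /f (idxE k) // indicE mem_set ?mulr1 //.
  by exists k.
have fC x : (~` \bigcup_k E k) x -> f x = 0.
  by move=> nx; rewrite /f indicE memNset // mulr0.
have mf : measurable_fun setT f.
  rewrite -(setUv (\bigcup_k E k)); apply/measurable_funU => //; split.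
    apply/measurable_fun_bigcup => // k.
    apply: (eq_measurable_fun (v k)) => [x /set_mem Ekx|]; first by rewrite (fE k).
    exact: measurable_funS (measurable_L (v k)).
  apply: (eq_measurable_fun (fun=> 0 : R)) => // x /set_mem nx.
  by rewrite fC.
have mpf D : measurable D -> measurable_fun D (fun x => (`|f x| `^ p)%:E).
  by move=> mD; apply: measurable_powL => //; exact: measurable_funS mf.
have Lf : f \in Lfun mu p%:E.
  apply: Lfun_powR => //; rewrite -(setUv (\bigcup_k E k)) ge0_integral_setU //; last 2 first.
  - by rewrite setUv; exact: mpf.
  - exact/disj_setPCl.
  rewrite [X in (_ + X)%E]integral0_eq ?adde0; last first.
    by move=> x nx; rewrite fC // normr0 powR0 ?gt_eqF.
  rewrite ge0_integral_bigcup //; last exact: mpf.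
  apply: le_lt_trans sv; rewrite le_eqVlt; apply/orP; left; apply/eqP.
  apply: eq_eseriesr => k _; rewrite norm_restr //.
  by apply: eq_integral => x /set_mem Ekx; rewrite (fE k).
exists (toL mu p1 f); split=> [k|]; first by apply: restr_glue => // x; exact: fE.
apply: L_ext; have h1 := restrE (toL mu p1 f) mUc; have h3 := toLE p1 Lf.
have h0 := @zeroLE _ _ _ mu p p1.
near=> x => _; rewrite (near h1 x _ I) // (near h3 x _ I) // (near h0 x _ I) //.
rewrite indicE; have [/set_mem /fC ->|] := boolP (x \in _); last by rewrite mulr0.
by rewrite mul0r.
Unshelve. all: by end_near. Qed.

End Decomposition.

End DisjointSequences.

(** * Coordinates, norm and truncation in [ell_p] *)

Section EllP.
Variables (R : realType) (p : R) (p1 : (1 <= p%:E)%E).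
Implicit Types a b : ell p1.

Let p_gt0 : 0 < p.
Proof. by apply: lt_le_trans (_ : 0 < 1) _ => //; rewrite -lee_fin. Qed.

(** The counting measure has no null set but the empty one. *)
Lemma counting_ae (f g : nat -> R) : f = g %[ae (@counting nat R)] -> forall k, f k = g k.
Proof.
move=> [N [mN N0 fgN]] k; apply: contrapT => fgk.
have Nk : N k by apply: fgN => /= h; apply: fgk; exact: h.
move: N0; rewrite /counting /=; case: ifPn => // /asboolP fN.
move=> h; have /eqP := EFin_inj h; rewrite pnatr_eq0 finmap.cardfs_eq0 => /eqP N0.
by have := in_fset_set fN k; rewrite N0 finmap.in_fset0 mem_set.
Qed.

Lemma ell_ext a b : (forall k, a k = b k) -> a = b.
Proof. by move=> ab; apply: L_ext; apply: aeW => k _; exact: ab. Qed.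

Lemma ellD a b k : (a + b) k = a k + b k.
Proof. exact: counting_ae (addLE a b) k. Qed.

Lemma ellZ c a k : (c *: a) k = c * a k.
Proof. exact: counting_ae (scaleLE c a) k. Qed.

Lemma ell_norm a : ((`|a| `^ p)%:E = \sum_(k <oo) (`|a k| `^ p)%:E)%E.
Proof.
by rewrite normL_powR ge0_integral_count // => k; rewrite lee_fin powR_ge0.
Qed.

Lemma ell_exists (f : nat -> R) : (\sum_(k <oo) (`|f k| `^ p)%:E < +oo)%E ->
  exists a : ell p1, forall k, a k = f k.
Proof.
move=> sf; exists (toL counting p1 f) => k; move: k.
apply: counting_ae; apply: toLE; apply: Lfun_powR => //.
by rewrite ge0_integral_count // => k; rewrite lee_fin powR_ge0.
Qed.

(** Tails of a convergent series vanish. This lets a lower bound be checked on finite sums only. *)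
Lemma ell_truncation a (e : R) : 0 < e -> exists n (b : ell p1),
  [/\ `|a - b| < e, forall k, (k < n)%N -> b k = a k & forall k, (n <= k)%N -> b k = 0].
Proof.
move=> e0; have ep : 0 < e `^ p by rewrite powR_gt0.
have a0 k : (0 <= (`|a k| `^ p)%:E)%E by rewrite lee_fin powR_ge0.
have /nneseries_tail_cvg : (\sum_(0 <= k <oo) (`|a k| `^ p)%:E < +oo)%E.
  by rewrite -ell_norm ltry.
move=> /(_ (fun k _ => a0 k)) /fine_cvgP [fin cv].
have /cvgrPdist_lt /(_ _ ep) cv' := cv.
have [n [fn hn]] := @filter_ex _ \oo _ _ (filterI fin cv').
pose f k := if (k < n)%N then a k else 0.
have fle k : `|f k| `^ p <= `|a k| `^ p.
  by rewrite /f; case: ifP => // _; rewrite normr0 powR0 ?gt_eqF // powR_ge0.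
have [b bE] : exists b : ell p1, forall k, b k = f k.
  apply: ell_exists; apply: (@le_lt_trans _ _ (\sum_(k <oo) (`|a k| `^ p)%:E)%E).
    by apply: lee_nneseries => [k _ _|k _]; rewrite lee_fin ?powR_ge0.
  by rewrite -ell_norm ltry.
exists n, b; split=> [|k kn|k nk]; last 2 first.
- by rewrite bE /f kn.
- by rewrite bE /f ltnNge nk.
have abE k : (a - b) k = if (k < n)%N then 0 else a k.
  rewrite ellD -scaleN1r ellZ bE /f mulN1r; case: ifP => _; first by rewrite subrr.
  by rewrite subr0.
have nE : ((`|a - b| `^ p)%:E = \sum_(n <= k <oo) (`|a k| `^ p)%:E)%E.
  rewrite ell_norm (nneseries_split 0 n) => [|k _]; last by rewrite lee_fin powR_ge0.
  rewrite big_nat_cond big1 ?add0e => [|k /andP[/andP[_ kn] _]].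
    rewrite add0n; congr (limn _); apply/funext => m.
    by apply: eq_big_nat => k /andP[nk _]; rewrite abE ltnNge nk.
  by rewrite abE kn normr0 powR0 // gt_eqF.
move: hn => /=; rewrite -nE /= sub0r normrN ger0_norm ?powR_ge0 //.
apply: contraTT; rewrite -!leNgt => h.
by rewrite ge0_ler_powR ?nnegrE // ltW.
Qed.

End EllP.

Section BoundedBelow.
Variable R : realType.
Implicit Types V W : normedModType R.

Lemma closed_of_approx V (A : set V) :
  (forall x, (forall e : R, 0 < e -> exists2 y, A y & `|x - y| < e) -> A x) ->
  closed A.
Proof.
move=> h x clx; apply: h => e e0.
have [y [Ay xy]] := clx (ball x e) (nbhsx_ballx x e e0).
by exists y => //; move: xy; rewrite -ball_normE.
Qed.

Lemma bounded_below_isomorphism V W (A : set V) (f : V -> W) (c : R) :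
  A 0 -> (forall a x y, A x -> A y -> A (a *: x + y)) ->
  operator_on A f -> 0 < c -> (forall x, A x -> c * `|x| <= `|f x|) ->
  isomorphism_on A f (f @` A).
Proof.
move=> A0 Al [fl fb] c0 fc; split=> //.
pose g w := xget 0 [set x | A x /\ f x = w].
have fB x y : A x -> A y -> f (x - y) = f x - f y.
  by move=> Ax Ay; rewrite addrC -scaleN1r fl // scaleN1r addrC.
have gK x : A x -> g (f x) = x.
  move=> Ax; rewrite /g; case: xgetP => [y _ [Ay fyx]|/(_ x)[]//].
  apply/eqP; rewrite -subr_eq0 -normr_le0 -(pmulr_rle0 _ c0).
  have Ayx : A (y - x) by rewrite addrC -scaleN1r; exact: Al.
  by rewrite (le_trans (fc _ Ayx)) // fB // fyx subrr normr0.
exists g; split=> [|x Ax|_ [x Ax <-]]; last 2 first.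
- by split; [exists x|exact: gK].
- by rewrite gK.
split=> [a _ _ [x Ax <-] [y Ay <-]|].
  by rewrite -fl // !gK //; exact: Al.
exists c^-1 => _ [x Ax <-]; rewrite gK // mulrC ler_pdivlMr // mulrC.
exact: fc.
Qed.

(** A line is closed. A functional norming [y] gives a projection of norm at most 1 onto the line;
    its complement kills [t *: y], so [w] is at distance at most [2 * |w - t *: y|] from its
    projection. *)
Lemma line_approx V (y w : V) : y != 0 ->
  (forall e : R, 0 < e -> exists t, `|w - t *: y| < e) -> exists t, w = t *: y.
Proof.
move=> y0 h; have [phi [phil phib phiy]] := norming_functional y.
have ny : `|y| != 0 by rewrite normr_eq0.
exists (phi w / `|y|); apply/eqP; rewrite -subr_eq0 -normr_le0.
apply/ler_addgt0Pr => e e0; rewrite add0r.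
have [t /ltW wt] := h _ (divr_gt0 e0 (ltr0Sn _ 1)).
have -> : w - (phi w / `|y|) *: y = (w - t *: y) - (phi (w - t *: y) / `|y|) *: y.
  have -> : phi (w - t *: y) = phi w - t * `|y|.
    by rewrite addrC -scaleNr phil phiy mulNr addrC.
  by rewrite mulrBl mulfK // scalerBl opprB addrA subrK.
apply: (le_trans (ler_normB _ _)); rewrite normrZ normrM normfV normr_id.
by rewrite divfK // [leRHS](splitr e) lerD // (le_trans (phib _)).
Qed.

End BoundedBelow.

Section OperatorLemmas.
Variables (R : realType) (V W : normedModType R) (f : V -> W).
Hypothesis opf : operator f.

Lemma operator0 : f 0 = 0.
Proof.
by have := opf.1 (-1) 0 0 I I; rewrite scaler0 addr0 scaleN1r addNr.
Qed.

Lemma operatorD x y : f (x + y) = f x + f y.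
Proof. by have := opf.1 1 x y I I; rewrite !scale1r. Qed.

Lemma operatorZ a x : f (a *: x) = a *: f x.
Proof. by have := opf.1 a x 0 I I; rewrite operator0 !addr0. Qed.

Lemma operatorB x y : f (x - y) = f x - f y.
Proof. by rewrite -scaleN1r operatorD operatorZ scaleN1r. Qed.

Lemma operator_sum n (x : nat -> V) : f (\sum_(k < n) x k) = \sum_(k < n) f (x k).
Proof.
elim: n => [|n IH]; first by rewrite !big_ord0 operator0.
by rewrite !big_ord_recr operatorD IH.
Qed.

Lemma operator_bound : exists2 M : R, 0 < M & forall x, `|f x| <= M * `|x|.
Proof.
have [M fM] := opf.2; exists (`|M| + 1); first by rewrite ltr_pwDr.
move=> x; apply: le_trans (fM x I) _; rewrite ler_wpM2r //.
by rewrite (le_trans (ler_norm M)) // lerDl.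
Qed.

End OperatorLemmas.

Lemma operator_comp (R : realType) (V W X : normedModType R) (f : V -> W)
    (g : W -> X) : operator f -> operator g -> operator (g \o f).
Proof.
move=> opf og; split=> [a x y _ _ /=|].
  by rewrite (operatorD opf) (operatorZ opf) (operatorD og) (operatorZ og).
have [M M0 fM] := operator_bound opf; have [N N0 gN] := operator_bound og.
exists (N * M) => x _ /=; apply: le_trans (gN _) _.
by rewrite -mulrA ler_pM2l.
Qed.

(** * The copy of [ell_p] spanned by a disjoint sequence *)

Section Synthesis.
Context d (T : measurableType d) (R : realType) (mu : {measure set T -> \bar R}).
Variables (p : R) (p1 : (1 <= p%:E)%E).
Local Notation L := (LspaceType mu p1).
Variables (E : nat -> set T) (y : nat -> L) (c : R).
Implicit Types a b : ell p1.
Hypotheses (mE : forall k, measurable (E k)) (tE : trivIset setT E).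
Hypotheses (yE : forall k, restr (E k) (y k) = y k).
Hypotheses (c0 : 0 < c) (cy : forall k, c <= `|y k|) (y1 : forall k, `|y k| <= 1).

Let p_gt0 : 0 < p.
Proof. by apply: lt_le_trans (_ : 0 < 1) _ => //; rewrite -lee_fin. Qed.

Let mUc : measurable (~` \bigcup_k E k).
Proof. by apply: measurableC; exact: bigcup_measurable. Qed.

Let restr_scaled (a : R) k : restr (E k) (a *: y k) = a *: y k.
Proof. by rewrite restrZ // yE. Qed.

Lemma synthesis_exists (a : ell p1) : exists u : L,
  (forall k, restr (E k) u = a k *: y k) /\ restr (~` \bigcup_k E k) u = 0.
Proof.
have [|u [hu hu0]] := glue mE tE (v := fun k => a k *: y k).
  apply: (@le_lt_trans _ _ (\sum_(k <oo) (`|a k| `^ p)%:E)%E).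
    apply: lee_nneseries => [k _ _|k _]; rewrite lee_fin ?powR_ge0 //.
    rewrite restr_scaled normrZ (ge0_ler_powR (ltW p_gt0)) ?nnegrE ?mulr_ge0 //.
    by rewrite ler_piMr.
  by rewrite -ell_norm ltry.
by exists u; split=> // k; rewrite hu restr_scaled.
Qed.

(** The sum of the series with terms [a k *: y k], pinned down by its restrictions. *)
Definition synthesis (a : ell p1) : L := projT1 (cid (synthesis_exists a)).

Lemma synthesisE a k : restr (E k) (synthesis a) = a k *: y k.
Proof. by rewrite /synthesis; case: cid => u [] /=. Qed.

Lemma synthesisC a : restr (~` \bigcup_k E k) (synthesis a) = 0.
Proof. by rewrite /synthesis; case: cid => u [] /=. Qed.

Lemma synthesis_unique a u : (forall k, restr (E k) u = a k *: y k) ->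
  restr (~` \bigcup_k E k) u = 0 -> u = synthesis a.
Proof.
move=> uE uC; apply: (restr_ext mE tE) => [k|]; first by rewrite uE synthesisE.
by rewrite uC synthesisC.
Qed.

Lemma synthesis_linear t a b : synthesis (t *: a + b) = t *: synthesis a + synthesis b.
Proof.
apply/esym/synthesis_unique => [k|]; rewrite restr_lin //.
  by rewrite !synthesisE ellD ellZ scalerDl scalerA.
by rewrite !synthesisC scaler0 addr0.
Qed.

Lemma synthesis_finite a n : (forall k, (n <= k)%N -> a k = 0) ->
  synthesis a = \sum_(k < n) a k *: y k.
Proof.
move=> an; apply/esym/synthesis_unique => [k|]; rewrite (restr_sum _ (fun k => a k *: y k)) //.
  have [kn|nk] := ltnP k n.
    rewrite (bigD1 (Ordinal kn)) //= restr_scaled big1 ?addr0 // => j jk.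
    rewrite -restr_scaled restr_restr // (_ : _ `&` _ = set0) ?restr_set0 //.
    by have /trivIsetP := tE; apply => //; rewrite eq_sym.
  rewrite an // scale0r big1 // => j _.
  rewrite -restr_scaled restr_restr // (_ : _ `&` _ = set0) ?restr_set0 //.
  have /trivIsetP := tE; apply => //.
  by rewrite gtn_eqF // (leq_trans (ltn_ord j)).
rewrite big1 // => j _; rewrite -restr_scaled restr_restr //.
rewrite (_ : _ `&` _ = set0) ?restr_set0 //.
by apply/disjoints_subset; apply: subsetC => x Ejx; exists j.
Qed.

Lemma synthesis_norm a : ((`|synthesis a| `^ p)%:E =
  \sum_(k <oo) (`|a k| `^ p * `|y k| `^ p)%:E)%E.
Proof.
rewrite (norm_series mE tE) synthesisC normr0 powR0 ?gt_eqF // adde0.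
by apply: eq_eseriesr => k _; rewrite synthesisE normrZ powRM.
Qed.

Lemma synthesis_le a : `|synthesis a| <= `|a|.
Proof.
apply: (ler_powR_inv p_gt0) => //; rewrite -lee_fin synthesis_norm ell_norm.
apply: lee_nneseries => [k _ _|k _]; rewrite lee_fin ?mulr_ge0 ?powR_ge0 //.
rewrite ler_piMr ?powR_ge0 //.
have -> : 1 = 1 `^ p :> R by rewrite powR1.
by rewrite (ge0_ler_powR (ltW p_gt0)) ?nnegrE.
Qed.

Lemma synthesis_ge a : c * `|a| <= `|synthesis a|.
Proof.
have c0' := ltW c0.
apply: (ler_powR_inv p_gt0); rewrite ?mulr_ge0 // powRM // -lee_fin synthesis_norm.
rewrite EFinM ell_norm -nneseriesZl => [|k _]; last by rewrite lee_fin powR_ge0.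
apply: lee_nneseries => [k _ _|k _]; first by rewrite -EFinM lee_fin mulr_ge0 ?powR_ge0.
rewrite -EFinM lee_fin mulrC ler_wpM2l ?powR_ge0 //.
by rewrite (ge0_ler_powR (ltW p_gt0)) ?nnegrE.
Qed.

(** These conditions on restrictions survive limits, which makes the range closed. Conversely the
    lower bound [c] on the [|y k|] forces the coefficients to be [p]-summable. *)
Lemma range_synthesisP u : range synthesis u <->
  (forall k, exists t, restr (E k) u = t *: y k) /\ restr (~` \bigcup_k E k) u = 0.
Proof.
split=> [[a _ <-]|[/choice [a ua] uC]].
  by split=> [k|]; [exists (a k); exact: synthesisE|exact: synthesisC].
have [|b ba] := ell_exists p1 (f := a).
  have cp : 0 < c `^ p by rewrite powR_gt0.
  have c0' := ltW c0.
  have : ((`|u| `^ p)%:E < +oo)%E by rewrite ltry.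
  rewrite (norm_series mE tE) uC normr0 powR0 ?gt_eqF // adde0 => h.
  rewrite -(@lte_pmul2l _ (c `^ p)%:E) ?lte_fin // gt0_muley ?lte_fin //.
  rewrite -nneseriesZl => [|k _]; last by rewrite lee_fin powR_ge0.
  apply: le_lt_trans h; apply: lee_nneseries => [k _ _|k _].
    by rewrite -EFinM lee_fin mulr_ge0 ?powR_ge0.
  rewrite -EFinM lee_fin ua normrZ powRM // mulrC ler_wpM2l ?powR_ge0 //.
  by rewrite (ge0_ler_powR (ltW p_gt0)) ?nnegrE.
by exists b => //; apply/esym/synthesis_unique => // k; rewrite ba ua.
Qed.

Lemma closed_range_synthesis : closed_subspace (range synthesis).
Proof.
split.
- apply: closed_of_approx => u hu; apply/range_synthesisP.
  split=> [k|].
    apply: line_approx => [|e /hu [v /range_synthesisP [/(_ k) [t vt] _] uv]].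
      by rewrite -normr_gt0 (lt_le_trans c0).
    exists t; rewrite -vt -restrB //; exact: le_lt_trans (norm_restr_le _ _) uv.
  apply/eqP; rewrite -normr_le0; apply/ler_addgt0Pr => e e0; rewrite add0r.
  have [v /range_synthesisP [_ vC] /ltW uv] := hu _ e0.
  rewrite -[X in `|X|]subr0 -vC -restrB //; exact: le_trans (norm_restr_le _ _) uv.
- exists 0 => //; apply/esym/synthesis_unique => [k|]; rewrite restr0 //.
  rewrite (_ : (0 : ell p1) k = 0) ?scale0r //.
  by rewrite -(scale0r (0 : ell p1)) ellZ mul0r.
- by move=> t _ _ [a _ <-] [b _ <-]; exists (t *: a + b) => //; exact: synthesis_linear.
Qed.

Lemma operator_synthesis : operator synthesis.
Proof.
split=> [t a b _ _|]; first exact: synthesis_linear.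
by exists 1 => a _; rewrite mul1r synthesis_le.
Qed.

Lemma range_synthesis_ell : isomorphic_to (ell p1) (range synthesis).
Proof.
have [_ [g [og g1 g2]]] :=
  bounded_below_isomorphism I (fun _ _ _ _ _ => I) operator_synthesis c0
    (fun a _ => synthesis_ge a).
by exists g; split=> //; exists synthesis; split=> //; exact: operator_synthesis.
Qed.

Lemma range_synthesis_isomorphism (W : normedModType R) (S : L -> W) (c1 : R) :
  operator S -> 0 < c1 ->
  (forall (a : ell p1) n, (forall k, (n <= k)%N -> a k = 0) ->
     c1 * `|a| <= `|\sum_(k < n) a k *: S (y k)|) ->
  isomorphism_on (range synthesis) S (S @` range synthesis).
Proof.
move=> oS c1_gt0 Sy; have [M M0 SM] := operator_bound oS.
have [clo r0 rl] := closed_range_synthesis.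
apply: (bounded_below_isomorphism r0 rl _ c1_gt0) => [|_ [a _ <-]].
  by split=> [t u v _ _|]; [exact: oS.1|exists M => u _].
apply: (@le_trans _ _ (c1 * `|a|)).
  by rewrite ler_wpM2l ?synthesis_le // ltW.
apply/ler_addgt0Pr => e e0.
have cM : 0 < c1 + M by rewrite addr_gt0.
(* Replacing [a] by [b] costs [c1] times the error on the left-hand side and [M] times it under
   [S]. *)
have [n [b [ab _ bn]]] := ell_truncation a (divr_gt0 e0 cM).
have h1 := Sy b n bn.
have h2 : \sum_(k < n) b k *: S (y k) = S (synthesis b).
  rewrite (synthesis_finite bn) (operator_sum oS _ (fun k => b k *: y k)).
  by apply: eq_bigr => k _; rewrite operatorZ.
have h3 : `|S (synthesis b)| <= `|S (synthesis a)| + M * `|a - b|.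
  rewrite -[synthesis b](subKr (synthesis a)) operatorB //.
  apply: (le_trans (ler_normB _ _)); rewrite lerD2l (le_trans (SM _)) // ler_pM2l //.
  rewrite -(operatorB operator_synthesis); exact: synthesis_le.
have h4 : c1 * `|a| <= c1 * `|b| + c1 * `|a - b|.
  rewrite -mulrDr ler_pM2l // -{1}(subrK b a) addrC; exact: ler_normD.
rewrite h2 in h1; rewrite ltr_pdivlMr // in ab; nra.
Qed.

End Synthesis.

(** * The estimate [|S u|_p <= e |u|_p + M |u|_2] *)

Section LowerEstimate.
Context d (T : measurableType d) (R : realType) (mu : {measure set T -> \bar R}).
Variables (p : R) (p1 : (1 <= p%:E)%E).
Local Notation L := (LspaceType mu p1).

Let p_gt0 : 0 < p.
Proof. by apply: lt_le_trans (_ : 0 < 1) _ => //; rewrite -lee_fin. Qed.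

Lemma ell_norm_finite (a : ell p1) n : (forall k, (n <= k)%N -> a k = 0) ->
  `|a| `^ p = \sum_(k < n) `|a k| `^ p.
Proof.
move=> an; apply: EFin_inj.
rewrite ell_norm (nneseries_split 0 n) => [|k _]; last by rewrite lee_fin powR_ge0.
rewrite [X in (_ + X)%E](_ : _ = 0%E) ?adde0; last first.
  by apply: eseries0 => k nk _; rewrite an // normr0 powR0 ?gt_eqF.
by rewrite add0n big_mkord -sumEFin.
Qed.

Lemma sum_geometric_lt1 n : \sum_(k < n) ((2 ^ k.+1)%:R)^-1 <= 1 :> R.
Proof.
suff -> : \sum_(k < n) ((2 ^ k.+1)%:R)^-1 = 1 - ((2 ^ n)%:R)^-1 :> R.
  by rewrite gerBl invr_ge0.
elim: n => [|n IH]; first by rewrite big_ord0 expn0 invr1 subrr.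
rewrite big_ord_recr /= IH expnS natrM invfM; field.
by rewrite pnatr_eq0 expn_eq0.
Qed.

(** The disjoint parts [v k] have norm at least [c / 2], so their combination has norm at least
    [c / 2 * |a|]. Each coefficient is at most [|a|], so the geometric errors together cost at most
    [c / 4 * |a|]. *)
Lemma lower_p_estimate (w : nat -> L) (G : nat -> set T) (c : R) :
  (forall k, measurable (G k)) -> trivIset setT G -> 0 < c ->
  (forall k, c <= `|w k|) ->
  (forall k, `|w k - restr (G k) (w k)| <= c / 4 * ((2 ^ k.+1)%:R)^-1) ->
  forall (a : ell p1) n, (forall k, (n <= k)%N -> a k = 0) ->
    c / 4 * `|a| <= `|\sum_(k < n) a k *: w k|.
Proof.
move=> mG tG c0 wc wG a n an; pose v k := restr (G k) (w k).
have vE (t : R) k : restr (G k) (t *: v k) = t *: v k.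
  by rewrite restrZ // /v restr_restr // setIid.
have inv2 k : ((2 ^ k.+1)%:R)^-1 <= 1 :> R by rewrite invf_le1 ?ler1n ?ltr0n ?expn_gt0.
have vc k : c / 2 <= `|v k|.
  have := ler_normD (w k - v k) (v k); rewrite subrK => h.
  have := wc k; have := wG k; have := inv2 k; rewrite -/(v k); nra.
have ak k : (k < n)%N -> `|a k| <= `|a|.
  move=> kn; rewrite leNgt; apply/negP => h.
  have : `|a| `^ p < `|a k| `^ p by rewrite gt0_ltr_powR ?nnegrE.
  by rewrite (ell_norm_finite an) (bigD1 (Ordinal kn)) //= ltNge lerDl sumr_ge0.
have nv : c / 2 * `|a| <= `|\sum_(k < n) a k *: v k|.
  rewrite leNgt; apply/negP => h.
  have : `|\sum_(k < n) a k *: v k| `^ p < (c / 2 * `|a|) `^ p.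
    by rewrite gt0_ltr_powR ?nnegrE // mulr_ge0 // divr_ge0 // ltW.
  rewrite (norm_disj_sum (y := fun k => a k *: v k) n mG tG (fun k => vE (a k) k)).
  rewrite powRM //; last by rewrite divr_ge0 // ltW.
  rewrite (ell_norm_finite an) mulr_sumr ltNge ler_sum // => k _.
  rewrite normrZ [leRHS]powRM // mulrC ler_wpM2l ?powR_ge0 //.
  by rewrite (ge0_ler_powR (ltW p_gt0)) ?nnegrE // divr_ge0 // ltW.
have nr : `|\sum_(k < n) a k *: (w k - v k)| <= c / 4 * `|a|.
  apply: (le_trans (ler_norm_sum _ _ _)).
  apply: (@le_trans _ _ (\sum_(k < n) c / 4 * `|a| * ((2 ^ k.+1)%:R)^-1)).
    apply: ler_sum => k _; rewrite normrZ mulrAC mulrC ler_pM //.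
    exact: ak.
  by rewrite -mulr_sumr ler_piMr ?sum_geometric_lt1 // mulr_ge0 // divr_ge0 // ltW.
have -> : \sum_(k < n) a k *: w k =
    \sum_(k < n) a k *: v k + \sum_(k < n) a k *: (w k - v k).
  by rewrite -big_split; apply: eq_bigr => k _; rewrite /= -scalerDr addrC subrK.
have := lerB_normD (\sum_(k < n) a k *: v k) (\sum_(k < n) a k *: (w k - v k)).
lra.
Qed.

End LowerEstimate.

Section SquareFunction.
Context d (T : measurableType d) (R : realType) (mu : {measure set T -> \bar R}).
Variables (p : R) (p1 : (1 <= p%:E)%E).
Hypotheses (p2 : 2 < p) (mu1 : (mu setT <= 1)%E).
Local Notation L := (LspaceType mu p1).

Let p_gt0 : 0 < p. Proof. exact: lt_trans p2. Qed.
Let p2' : 2 <= p. Proof. exact: ltW. Qed.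

(** Signs are chosen one at a time: by the parallelogram law the larger of [sq (u + z n)] and
    [sq (u - z n)] is at least [sq u + sq (z n)]. *)
Lemma good_signs (z : nat -> L) n : exists s : nat -> R,
  (forall k, `|s k| = 1) /\
  \sum_(k < n) sq (z k) <= sq (\sum_(k < n) s k *: z k).
Proof.
elim: n => [|n [s [s1 hs]]].
  exists (fun=> 1); split=> [k|]; first by rewrite normr1.
  by rewrite !big_ord0 sq_ge0.
set u := \sum_(k < n) s k *: z k in hs.
have par := sq_parallelogram p2' mu1 u (z n).
have [t t1 ht] : exists2 t : R, `|t| = 1 & sq u + sq (z n) <= sq (u + t *: z n).
  have [h|h] := leP (sq (u - z n)) (sq (u + z n)).
    by exists 1; rewrite ?normr1 // scale1r; lra.
  by exists (-1); rewrite ?normrN1 // scaleN1r; lra.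
exists (fun k => if (k < n)%N then s k else t); split=> [k|].
  by case: ifP.
rewrite !big_ord_recr /= ltnn (eq_bigr (fun k : 'I_n => s k *: z k)) => [|k _].
  by apply: le_trans ht; rewrite lerD2r.
by rewrite ltn_ord.
Qed.

Lemma sublinear_growth (K : R) : exists m : nat, K * m%:R `^ (2 / p) < m%:R.
Proof.
pose s := 1 - 2 / p.
have s0 : 0 < s by rewrite subr_gt0 ltr_pdivrMr // mul1r.
(* Beyond [K ^ (1 / s)] the power [m ^ s] exceeds [K]; the maximum with 1 keeps [m] positive. *)
pose X := Num.max 1 (K `^ s^-1).
have [m mX] : exists m : nat, X < m%:R.
  by exists (Num.truncn X).+1; exact: truncnS_gt.
exists m; have X1 : 1 <= X by rewrite le_max lexx.
have m0 : 0 < m%:R :> R by apply: lt_trans mX; exact: lt_le_trans X1.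
have [K0|K0] := leP K 0.
  by apply: le_lt_trans m0; rewrite mulr_le0_ge0 ?powR_ge0.
have mE : m%:R = m%:R `^ s * m%:R `^ (2 / p) :> R.
  by rewrite -powRD ?subrK ?powRr1 ?ltW // oner_eq0.
rewrite [ltRHS]mE ltr_pM2r ?powR_gt0 //.
have -> : K = (K `^ s^-1) `^ s by rewrite -powRrM mulVf ?gt_eqF // powRr1 ?ltW.
rewrite gt0_ltr_powR ?nnegrE ?powR_ge0 ?ltW //.
by apply: le_lt_trans mX; rewrite le_max lexx orbT.
Qed.

(* With good signs, the second moment of the signed sum of [N] images is at least
   the sum of their second moments, while it is at most of order [N^(2/p)]. *)
Lemma disjoint_images_small (S : L -> L) (E : nat -> set T) (y : nat -> L) :
  operator S -> (forall k, measurable (E k)) -> trivIset setT E ->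
  (forall k, restr (E k) (y k) = y k) -> (forall k, `|y k| <= 1) ->
  forall N e, 0 < e -> exists2 n, (N <= n)%N & sq (S (y n)) < e.
Proof.
move=> oS mE tE yE y1 N e e0; apply: contrapT => h.
have {}h k : e <= sq (S (y (N + k)%N)).
  by rewrite leNgt; apply/negP => h'; apply: h; exists (N + k)%N => //; exact: leq_addr.
have [M M0 SM] := operator_bound oS.
(* If all moments from [N] on were at least [e], then [m * e <= sq (S v) <= 2 * |S v| ^+ 2 <= 2 * M
   ^+ 2 * m ^ (2 / p)]; this [m] violates it. *)
have [m] := sublinear_growth (2 * M ^+ 2 / e).
apply/negP; rewrite -leNgt.
have [s [s1 hs]] := good_signs (fun k => S (y (N + k)%N)) m.
set v := \sum_(k < m) s k *: y (N + k)%N.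
have Sv : \sum_(k < m) s k *: S (y (N + k)%N) = S v.
  rewrite (operator_sum oS _ (fun k => s k *: y (N + k)%N)).
  by apply: eq_bigr => k _; rewrite operatorZ.
have nv : `|v| `^ p <= m%:R.
  rewrite /v (norm_disj_sum (E := fun k => E (N + k)%N)
    (y := fun k => s k *: y (N + k)%N)) //.
  - rewrite -[leRHS](_ : \sum_(k < m) 1 = _); last by rewrite sumr_const card_ord.
    apply: ler_sum => k _; rewrite normrZ s1 mul1r.
    have -> : 1 = 1 `^ p :> R by rewrite powR1.
    by rewrite (ge0_ler_powR (ltW p_gt0)) ?nnegrE.
  - apply/trivIsetP => i j _ _ ij; have /trivIsetP := tE; apply => //.
    by rewrite eqn_add2l.
  - by move=> k; rewrite restrZ // yE.
have nv2 : `|v| ^+ 2 <= m%:R `^ (2 / p).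
  have -> : `|v| ^+ 2 = (`|v| `^ p) `^ (2 / p).
    by rewrite -powRrM mulrC divfK ?gt_eqF // powR_mulrn.
  by rewrite ge0_ler_powR ?nnegrE ?powR_ge0 ?divr_ge0 // ltW.
have me : m%:R * e <= \sum_(k < m) sq (S (y (N + k)%N)).
  rewrite -[leLHS](_ : \sum_(k < m) e = _).
    by apply: ler_sum => k _; exact: h.
  by rewrite sumr_const card_ord mulr_natl.
rewrite Sv in hs; have h2 := sq_le_norm p2' mu1 (S v).
have h3 : `|S v| ^+ 2 <= M ^+ 2 * `|v| ^+ 2.
  by rewrite -exprMn lerXn2r ?nnegrE // mulr_ge0 // ltW.
have M2 : 0 <= M ^+ 2 by rewrite sqr_ge0.
rewrite mulrAC ler_pdivlMr //; nra.
Qed.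

(** The estimate fails for every constant [n]. After normalization [n * |x_n|_2 < |S x_n| <= C],
    with [C] a bound for [S], so the second moments tend to 0. *)
Lemma large_images_small_moments (S : L -> L) (e : R) : operator S -> 0 < e ->
  ~ (exists2 M : R, 0 <= M & forall u, `|S u| <= e * `|u| + M * Num.sqrt (sq u)) ->
  exists x : nat -> L, [/\ forall n, `|x n| = 1, forall n, e <= `|S (x n)| &
    forall N r, 0 < r -> exists2 n, (N <= n)%N & sq (x n) < r].
Proof.
move=> oS e0 hM; have [C C0 SC] := operator_bound oS.
have /choice [u hu] n : exists u, e * `|u| + n%:R * Num.sqrt (sq u) < `|S u|.
  apply: contrapT => h; apply: hM; exists n%:R => // u.
  by rewrite leNgt; apply/negP => h'; apply: h; exists u.
have u0 n : 0 < `|u n|.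
  rewrite normr_gt0; apply/eqP => un0; have := hu n.
  rewrite un0 (operator0 oS) !normr0 mulr0 add0r ltNge.
  by rewrite mulr_ge0 // sqrtr_ge0.
pose x n := `|u n|^-1 *: u n.
have x1 n : `|x n| = 1 by rewrite normrZ normfV normr_id mulVf // gt_eqF.
have xS n : e + n%:R * Num.sqrt (sq (x n)) < `|S (x n)|.
  rewrite (operatorZ oS) normrZ normfV normr_id [ltRHS]mulrC ltr_pdivlMr //.
  apply: le_lt_trans (hu n); rewrite mulrDl lerD2l -mulrA ler_wpM2l //.
  rewrite sqZ // sqrtrM ?sqr_ge0 // sqrtr_sqr normfV normr_id mulrAC mulVf ?mul1r //.
  by rewrite gt_eqF.
exists x; split=> // [n|N r r0].
  by apply: le_trans (ltW (xS n)); rewrite lerDl mulr_ge0 // sqrtr_ge0.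
have sr : 0 < Num.sqrt r by rewrite sqrtr_gt0.
pose n := (N + (Num.truncn (C / Num.sqrt r)).+1)%N.
exists n; first exact: leq_addr.
rewrite ltNge; apply/negP => h.
have nC : C / Num.sqrt r < n%:R.
  by apply: lt_le_trans (truncnS_gt _) _; rewrite ler_nat leq_addl.
have h1 := xS n; have h2 := SC (x n); rewrite x1 mulr1 in h2.
have h3 : Num.sqrt r <= Num.sqrt (sq (x n)) by rewrite ler_sqrt // sq_ge0.
have h4 : n%:R * Num.sqrt r <= n%:R * Num.sqrt (sq (x n)) by rewrite ler_wpM2l.
by rewrite ltr_pdivrMr // in nC; lra.
Qed.

Lemma strictly_singular_estimate (S : L -> L) : operator S ->
  ell_strictly_singular p1 S -> forall e, 0 < e ->
  exists2 M : R, 0 <= M & forall u, `|S u| <= e * `|u| + M * Num.sqrt (sq u).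
Proof.
move=> oS ssS e e0; apply: contrapT => hM; apply: ssS.
have [x [x1 xS xsq]] := large_images_small_moments oS e0 hM.
have [C C0 SC] := operator_bound oS.
(* The tolerance [e / (2 * C)] becomes at most [e / 2] under [S], so the images of the disjoint
   vectors keep norm at least [e / 2]. *)
have [n_ [E [_ mE tE xE]]] := kadec_pelczynski p2' mu1 xsq
  (fun=> divr_gt0 e0 (mulr_gt0 (ltr0Sn R 1) C0)).
pose y k := restr (E k) (x (n_ k)).
have yE k : restr (E k) (y k) = y k by rewrite restr_restr // setIid.
have y1 k : `|y k| <= 1 by rewrite -(x1 (n_ k)) norm_restr_le.
have Sy k : e / 2 <= `|S (y k)|.
  have h1 : `|S (x (n_ k) - y k)| <= e / 2.
    apply: (le_trans (SC _)); apply: (@le_trans _ _ (C * (e / (2 * C)))).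
      by rewrite ler_pM2l //; exact: xE.
    by rewrite le_eqVlt; apply/orP; left; apply/eqP; field; rewrite gt_eqF.
  have := ler_normD (S (x (n_ k) - y k)) (S (y k)).
  rewrite -(operatorD oS) subrK => h2; have := xS (n_ k); lra.
have e2 : 0 < e / 2 by rewrite divr_gt0.
(* This is the tolerance of [lower_p_estimate] for [c = e / 2]. *)
have dl0 k : 0 < e / 2 / 4 * ((2 ^ k.+1)%:R)^-1.
  by rewrite mulr_gt0 ?divr_gt0 // invr_gt0 ltr0n expn_gt0.
(* The images are now nearly carried by disjoint sets [G k], unrelated to the sets [E (m_ k)]
   carrying the vectors themselves. *)
have [m_ [G [m_inc mG tG yG]]] := kadec_pelczynski p2' mu1
  (disjoint_images_small oS mE tE yE y1) dl0.
have m_inj i j : i != j -> m_ i != m_ j.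
  by rewrite !neq_ltn => /orP[/m_inc|/m_inc] ->; rewrite ?orbT.
have tE' : trivIset setT (fun k => E (m_ k)).
  by apply/trivIsetP => i j _ _ ij; have /trivIsetP := tE; apply => //; exact: m_inj.
have ec0 : 0 < e / 2 / C by rewrite divr_gt0.
have yc k : e / 2 / C <= `|y (m_ k)|.
  by rewrite ler_pdivrMr // [leRHS]mulrC (le_trans (Sy (m_ k)) (SC _)).
pose mE' k := mE (m_ k); pose yE' k := yE (m_ k); pose y1' k := y1 (m_ k).
exists (range (synthesis (y := fun k => y (m_ k)) (p1 := p1) mE' tE' yE' y1')); split.
- exact: (closed_range_synthesis mE' tE' yE' ec0 yc).
- exact: (range_synthesis_ell mE' tE' yE' ec0 yc).
- apply: (range_synthesis_isomorphism mE' tE' yE' ec0 yc y1' oS (c1 := e / 2 / 4)).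
    by rewrite divr_gt0.
  move=> a n an; exact: (lower_p_estimate (w := fun k => S (y (m_ k))) mG tG e2).
Qed.

End SquareFunction.

(** * Haar coefficients *)

Section UnitInterval.
Variable R : realType.
Local Notation mu := (unit_interval_measure R).
Local Notation leb := (@lebesgue_measure R).
Local Notation D := (`]0, 1[%classic : set (measurableTypeR R)).

Lemma unit_interval_measure_le (A : set (measurableTypeR R)) : measurable A ->
  (mu A <= leb A)%E.
Proof.
move=> mA; rewrite /unit_interval_measure /= /mrestr.
apply: le_measure => //; apply: mem_set => //.
by apply: measurableI => //; exact: measurable_itv.
Qed.

Lemma unit_interval_measureT : (mu setT <= 1)%E.
Proof.
rewrite /unit_interval_measure /= /mrestr setTI lebesgue_measure_itv /= lte_fin ltr01.
by rewrite oppr0 adde0.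
Qed.

Lemma ae_unit_interval (P : R -> Prop) : {ae leb, forall x, P x} -> {ae mu, forall x, P x}.
Proof.
move=> [N [mN N0 PN]]; exists N; split=> //; apply/eqP; rewrite eq_le measure_ge0 andbT.
by rewrite -N0; exact: unit_interval_measure_le.
Qed.

Lemma ae_in_unit_interval : {ae mu, forall x, D x}.
Proof.
exists (~` D); split=> //; first by apply: measurableC; exact: measurable_itv.
by rewrite /unit_interval_measure /= /mrestr setICl measure0.
Qed.

Lemma unit_interval_integral (B : set (measurableTypeR R)) (f : R -> \bar R) :
  measurable B -> measurable_fun B f ->
  (\int[mu]_(x in B) f x = \int[leb]_(x in B) (f \_ D) x)%E.
Proof.
move=> mB mf; have mD : measurable D by exact: measurable_itv.
rewrite -integral_mkcondr.
have -> : (\int[leb]_(x in B `&` D) f x = \int[mu]_(x in B `&` D) f x)%E.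
  apply: eq_measure_integral => A mA AB; rewrite /unit_interval_measure /= /mrestr.
  by rewrite setIidl // => x /AB[].
rewrite integral_mkcondr; apply: ae_eq_integral => //.
  apply/(measurable_restrict f mD mB); apply: measurable_funS mf => // x [].
have FF : Filter (almost_everywhere mu) by exact: ae_filter_ringOfSetsType.
move: ae_in_unit_interval; apply: filterS => x Dx Bx.
by rewrite patchE mem_set.
Qed.

End UnitInterval.

(** * Dyadic intervals and integrals over them *)

Section Dyadic.
Variables (R : realType) (p : R) (hp : 2 < p).
Local Notation mu := (unit_interval_measure R).
Local Notation leb := (@lebesgue_measure R).
Local Notation L := (Lp01 (lee1_gt2 hp)).
Implicit Types (u v : L) (n k m : nat).

Let p2 : 2 <= p. Proof. exact: ltW. Qed.
Let mu1 := unit_interval_measureT R.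

Definition mesh n : R := 2^-1 ^+ n.

Lemma mesh_gt0 n : 0 < mesh n.
Proof. by rewrite exprn_gt0 // invr_gt0. Qed.

Lemma meshS n : mesh n = 2 * mesh n.+1.
Proof. by rewrite /mesh exprS mulrA mulfV ?mul1r. Qed.

(** Half-open, so that the two halves partition it. The left end is free; dyadic intervals are those
    with [l = mesh n * k%:R]. *)
Definition cell (l : R) n : set (measurableTypeR R) := `[l, l + mesh n[%classic.

Lemma cellP l n x : cell l n x <-> l <= x /\ x < l + mesh n.
Proof. by rewrite /cell /= in_itv /=; split=> [/andP|] //; case=> -> ->. Qed.

Lemma measurable_cell l n : measurable (cell l n).
Proof. exact: measurable_itv. Qed.

Lemma leb_cell l n : leb (cell l n) = (mesh n)%:E.
Proof.
rewrite /cell lebesgue_measure_itv /= lte_fin ltrDl mesh_gt0.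
by rewrite -EFinB addrAC subrr add0r.
Qed.

(** An inequality because a cell may stick out of the unit interval. *)
Lemma mu_cell l n : (mu (cell l n) <= (mesh n)%:E)%E.
Proof. by rewrite -(leb_cell l n); apply: unit_interval_measure_le; exact: measurable_cell. Qed.

Lemma cellS l n : cell l n = cell l n.+1 `|` cell (l + mesh n.+1) n.+1.
Proof.
have m0 := mesh_gt0 n.+1; have mS := meshS n.
apply/seteqP; split=> x.
  move=> /cellP [h1 h2]; have [h|h] := ltP x (l + mesh n.+1); [left|right]; apply/cellP.
    by [].
  by split=> //; rewrite -addrA -mulr2n -mulr_natl -mS.
by move=> [|] /cellP [h1 h2]; apply/cellP; split; rewrite ?mS; lra.
Qed.

Lemma L_integrable u (B : set (measurableTypeR R)) : measurable B ->
  mu.-integrable B (EFin \o u).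
Proof.
move=> mB; apply: (@integrableS _ _ _ mu setT) => //.
apply/Lfun1_integrable; apply: (@Lfun_subset _ _ _ mu 1 p%:E) => //.
- exact: lee1_gt2.
- by rewrite ge0_fin_numE //; exact: le_lt_trans mu1 (ltry _).
- by rewrite lee_fin (le_trans _ p2) // ler1n.
- exact: memLfun.
Qed.

Definition cell_mass u l n : R := \int[mu]_(x in cell l n) u x.

Lemma cell_massS u l n :
  cell_mass u l n = cell_mass u l n.+1 + cell_mass u (l + mesh n.+1) n.+1.
Proof.
rewrite /cell_mass cellS Rintegral_setU //; try exact: measurable_cell.
  by rewrite -cellS; apply: L_integrable; exact: measurable_cell.
apply/disj_setPS => x [] /cellP [_ h] /cellP [h' _].
by have := lt_le_trans h h'; rewrite ltxx.
Qed.

Lemma cell_mass_linear a u v l n :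
  cell_mass (a *: u + v) l n = a * cell_mass u l n + cell_mass v l n.
Proof.
have mc := measurable_cell l n.
have iu := L_integrable u mc; have iv := L_integrable v mc.
rewrite /cell_mass -RintegralZl // -RintegralD //; last first.
  exact: (integrableZl mc a iu).
rewrite /Rintegral; congr fine; apply: ae_eq_integral => //.
- by case/integrableP: (L_integrable (a *: u + v) mc).
- by case/integrableP: (integrableD mc (integrableZl mc a iu) iv).
have h1 := addLE (a *: u) v; have h2 := scaleLE a u.
have FF : Filter (almost_everywhere mu) by exact: ae_filter_ringOfSetsType.
apply: (filterS2 _ _ h1 h2) => x /= e1 e2 _.
by rewrite (e1 I) (e2 I).
Qed.

(* Cauchy-Schwarz: expand the integral of [(u - t)^2] with [t] the average of [u]. *)
Lemma cell_mass_sqr u l n :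
  (mesh n)^-1 * cell_mass u l n ^+ 2 <= \int[mu]_(x in cell l n) (u x ^+ 2).
Proof.
have mc := measurable_cell l n; have iu := L_integrable u mc.
have iu2 : mu.-integrable (cell l n) (EFin \o (fun x => u x ^+ 2)).
  by apply: integrableS (sq_integrable p2 mu1 u).
pose t := (mesh n)^-1 * cell_mass u l n.
have it c : mu.-integrable (cell l n) (EFin \o (fun=> c : R)).
  apply/integrableP; split; first exact: measurable_cst.
  rewrite integral_cst //= ltey_eq fin_numM //.
  by rewrite ge0_fin_numE // (le_lt_trans (mu_cell l n)) ?ltry.
have : 0 <= \int[mu]_(x in cell l n) (u x ^+ 2 + (- 2 * t) * u x + t ^+ 2).
  apply: Rintegral_ge0 => x _.
  have -> : u x ^+ 2 + (- 2 * t) * u x + t ^+ 2 = (u x - t) ^+ 2 by ring.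
  exact: sqr_ge0.
have itu := integrableZl mc (- 2 * t) iu.
rewrite RintegralD //; last exact: (integrableD mc iu2 itu).
rewrite RintegralD // RintegralZl // Rintegral_cst // -/(cell_mass u l n).
have m0 := mesh_gt0 n.
have : fine (mu (cell l n)) <= mesh n.
  rewrite -lee_fin fineK ?mu_cell //.
  by rewrite ge0_fin_numE // (le_lt_trans (mu_cell l n)) ?ltry.
have tm : cell_mass u l n = mesh n * t by rewrite /t mulVKf // gt_eqF.
have -> : (mesh n)^-1 * cell_mass u l n ^+ 2 = mesh n * t ^+ 2.
  by rewrite tm; field; rewrite gt_eqF.
rewrite tm => h1 h2; have t2 : 0 <= t ^+ 2 by rewrite sqr_ge0.
nra.
Qed.

End Dyadic.

Section Haar.
Variables (R : realType) (p : R) (hp : 2 < p).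
Local Notation mu := (unit_interval_measure R).
Local Notation leb := (@lebesgue_measure R).
Local Notation L := (Lp01 (lee1_gt2 hp)).
Local Notation mesh := (mesh R).
Implicit Types (u v : L) (n k m : nat).

Let p2 : 2 <= p. Proof. exact: ltW. Qed.
Let mu1 := unit_interval_measureT R.

Definition dyadic_mass u n k : R := cell_mass u (mesh n * k%:R) n.

Lemma dyadic_half n k : mesh n * k%:R = mesh n.+1 * (2 * k)%:R.
Proof. by rewrite meshS natrM; ring. Qed.

Lemma dyadic_half' n k : mesh n * k%:R + mesh n.+1 = mesh n.+1 * (2 * k).+1%:R.
Proof. by rewrite meshS -[(2 * k).+1%:R]natr1 natrM; ring. Qed.

Lemma dyadic_massS u n k :
  dyadic_mass u n k = dyadic_mass u n.+1 (2 * k) + dyadic_mass u n.+1 (2 * k).+1.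
Proof. by rewrite {1}/dyadic_mass cell_massS dyadic_half' (dyadic_half n k). Qed.

Lemma sum_even_odd (f : nat -> R) N :
  \sum_(k < 2 * N) f k = \sum_(k < N) (f (2 * k)%N + f (2 * k).+1).
Proof.
elim: N => [|N IH]; first by rewrite muln0 !big_ord0.
by rewrite mulnS !big_ord_recr /= IH addrA.
Qed.

(** The squared [L_2] norm of the conditional expectation of [u] on the dyadic intervals of
    generation [n]. *)
Definition dyadic_energy u n : R :=
  (mesh n)^-1 * \sum_(k < 2 ^ n) dyadic_mass u n k ^+ 2.

(** Cauchy-Schwarz on each cell; successive halving of [[0, 1[] shows that the integrals of [u ^+ 2]
    over the cells of one generation add up to the same total. *)
Lemma dyadic_energy_le u n : dyadic_energy u n <= sq u.
Proof.
pose I m k := \int[mu]_(x in cell (mesh m * k%:R) m) (u x ^+ 2).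
pose t m := \sum_(k < 2 ^ m) I m k.
have iB (B : set (measurableTypeR R)) : measurable B ->
    mu.-integrable B (EFin \o (fun x => u x ^+ 2)).
  by move=> mB; apply: integrableS (sq_integrable p2 mu1 u).
have tS m : t m.+1 = t m.
  rewrite /t expnS (sum_even_odd (I m.+1)); apply: eq_bigr => k _.
  rewrite /I (cellS _ m) dyadic_half' (dyadic_half m k).
  rewrite Rintegral_setU //; try exact: measurable_cell.
    by apply: iB; apply: measurableU; exact: measurable_cell.
  apply/disj_setPS => x [] /cellP [_ h] /cellP [h' _].
  by move: h'; rewrite -natr1 mulrDr mulr1 leNgt h.
have tn m : t m = t 0%N by elim: m => // m; rewrite tS.
apply: (@le_trans _ _ (t n)).
  by rewrite /dyadic_energy mulr_sumr; apply: ler_sum => k _; exact: cell_mass_sqr.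
rewrite tn /t big_ord1 -lee_fin /sq /Rintegral !fineK; last 2 first.
- exact: integrable_fin_num (iB setT measurableT).
- apply: integrable_fin_num; first exact: measurable_cell.
  by apply: iB; exact: measurable_cell.
apply: ge0_subset_integral => //; first exact: measurable_cell.
  by have /integrableP [] := iB setT measurableT.
by move=> x _; rewrite lee_fin sqr_ge0.
Qed.

(* Heap numbering: [m = 2 ^ n + k] with [k < 2 ^ n] is the [k]-th dyadic interval
   of generation [n]. *)
Definition haar_coef u m : R :=
  if m is 0 then dyadic_mass u 0 0 else
  let n := trunc_log 2 m in let k := (m - 2 ^ n)%N in
  (Num.sqrt (mesh n))^-1 * (dyadic_mass u n.+1 (2 * k) - dyadic_mass u n.+1 (2 * k).+1).

Lemma haar_coef_linear a u v m :
  haar_coef (a *: u + v) m = a * haar_coef u m + haar_coef v m.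
Proof.
case: m => [|m]; rewrite /haar_coef /dyadic_mass !cell_mass_linear //.
ring.
Qed.

Lemma haar_coef_sqr u n k : (k < 2 ^ n)%N -> haar_coef u (2 ^ n + k) ^+ 2 =
  (mesh n)^-1 * (dyadic_mass u n.+1 (2 * k) - dyadic_mass u n.+1 (2 * k).+1) ^+ 2.
Proof.
move=> kn; have m0 : (0 < 2 ^ n + k)%N by rewrite addn_gt0 expn_gt0.
have tl : trunc_log 2 (2 ^ n + k) = n.
  by apply: trunc_log_eq => //; rewrite leq_addr expnS mul2n -addnn ltn_add2l.
rewrite /haar_coef; case: (2 ^ n + k)%N tl m0 (addKn (2 ^ n) k) => // m -> _ ->.
by rewrite exprMn exprVn sqr_sqrtr // ltW // mesh_gt0.
Qed.

(** Parseval for finitely many generations. If a cell has halves of masses [a] and [b], then [2 * (a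
    ^+ 2 + b ^+ 2) = (a + b) ^+ 2 + (a - b) ^+ 2]; the first term is the old energy, the second the
    new Haar coefficient. *)
Lemma haar_partial_sum u n : \sum_(m < 2 ^ n) haar_coef u m ^+ 2 = dyadic_energy u n.
Proof.
elim: n => [|n IH].
  by rewrite /dyadic_energy expn0 !big_ord1 /mesh expr0 invr1 mul1r.
rewrite expnS mul2n -addnn big_split_ord /= IH /dyadic_energy.
rewrite [in RHS]expnS (sum_even_odd (fun k => dyadic_mass u n.+1 k ^+ 2)) !mulr_sumr.
rewrite -big_split; apply: eq_bigr => k _ /=.
rewrite haar_coef_sqr // dyadic_massS meshS; field.
by rewrite gt_eqF // mesh_gt0.
Qed.

Lemma haar_coef_summable u : (\sum_(m <oo) (`|haar_coef u m| `^ 2)%:E <= (sq u)%:E)%E.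
Proof.
apply: lime_le; first by apply: is_cvg_nneseries => m _ _; rewrite lee_fin powR_ge0.
near=> N; apply: (@le_trans _ _ (\sum_(0 <= m < 2 ^ N) (`|haar_coef u m| `^ 2)%:E)%E).
  by apply: lee_sum_nneg_natr => //; exact/ltnW/ltn_expl.
rewrite sumEFin lee_fin big_mkord (eq_bigr (fun m : 'I__ => haar_coef u m ^+ 2)).
  by rewrite haar_partial_sum dyadic_energy_le.
by move=> m _; rewrite powR_mulrn // real_normK // num_real.
Unshelve. all: by end_near. Qed.

Lemma haar_map_exists u : exists a : ell2 R, forall m, a m = haar_coef u m.
Proof. by apply: ell_exists; apply: le_lt_trans (haar_coef_summable u) (ltry _). Qed.

Definition haar_map u : ell2 R := projT1 (cid (haar_map_exists u)).

Lemma haar_mapE u m : haar_map u m = haar_coef u m.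
Proof. by rewrite /haar_map; case: cid. Qed.

Lemma haar_map_norm u :
  ((`|haar_map u| ^+ 2)%:E = \sum_(m <oo) (`|haar_coef u m| `^ 2)%:E)%E.
Proof.
rewrite -powR_mulrn // ell_norm.
by apply: eq_eseriesr => m _; rewrite haar_mapE.
Qed.

Lemma operator_haar_map : operator haar_map.
Proof.
split=> [a u v _ _|].
  apply: ell_ext => m.
  by rewrite ellD ellZ !haar_mapE haar_coef_linear.
exists 2 => u _; rewrite -(ler_pXn2r (_ : 0 < 2)%N) ?nnegrE ?mulr_ge0 //.
apply: (@le_trans _ _ (sq u)).
  by rewrite -lee_fin haar_map_norm haar_coef_summable.
apply: le_trans (sq_le_norm p2 mu1 u) _; rewrite exprMn ler_wpM2r ?sqr_ge0 //.
by rewrite expr2 -natrM ler_nat.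
Qed.

Lemma dyadic_energy_haar u n : dyadic_energy u n <= `|haar_map u| ^+ 2.
Proof.
rewrite -lee_fin haar_map_norm -haar_partial_sum.
apply: le_trans (nneseries_lim_ge (2 ^ n) _); last first.
  by move=> m _ _; rewrite lee_fin powR_ge0.
rewrite sumEFin lee_fin big_mkord; apply: ler_sum => m _.
by rewrite powR_mulrn // real_normK // num_real.
Qed.

End Haar.

(** * The [L_2] norm is bounded by the Haar coefficients *)

Section HaarLowerBound.
Variables (R : realType) (p : R) (hp : 2 < p).
Local Notation mu := (unit_interval_measure R).
Local Notation leb := (@lebesgue_measure R).
Local Notation D := (`]0, 1[%classic : set (measurableTypeR R)).
Local Notation L := (Lp01 (lee1_gt2 hp)).
Local Notation mesh := (mesh R).
Implicit Types (u v : L) (n k m : nat).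

Let p2 : 2 <= p. Proof. exact: ltW. Qed.
Let mu1 := unit_interval_measureT R.

(** The value at negative [x] is a dummy that keeps every real number inside its own cell. *)
Definition cell_left (x : R) n : R :=
  if 0 <= x then mesh n * (Num.truncn (x / mesh n))%:R else x.

Lemma cell_leftP x n : cell (cell_left x n) n x.
Proof.
apply/cellP; rewrite /cell_left; have m0 := mesh_gt0 R n.
case: ifPn => x0; last by rewrite lexx ltrDl.
have xm : 0 <= x / mesh n by rewrite divr_ge0 // ltW.
have /andP[h1 h2] := truncn_itv xm.
split; first by rewrite mulrC -ler_pdivlMr.
by rewrite -[X in _ + X]mulr1 -mulrDr natr1 mulrC -ltr_pdivrMr.
Qed.

Lemma mesh_cvg0 : mesh n @[n --> \oo] --> 0.
Proof. by apply: cvg_expr; rewrite ger0_norm ?invr_ge0 // invf_lt1 // ltr1n. Qed.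

Lemma cell_nicely_shrinking x : nicely_shrinking x (fun n => cell (cell_left x n) n).
Proof.
split=> [n|]; first exact: measurable_cell.
(* The ball of radius [mesh n] about [x] contains the cell and has twice its Lebesgue measure. *)
exists (2, fun n => PosNum (mesh_gt0 R n)); split=> //=.
- exact: mesh_cvg0.
- move=> n y /cellP [h1 h2]; have /cellP [h3 h4] := cell_leftP x n.
  by rewrite -ball_normE /= ltr_norml; apply/andP; split; lra.
- move=> n; rewrite leb_cell lebesgue_measure_ball; last by apply: ltW; exact: mesh_gt0.
  by rewrite -EFinM lee_fin mulr_natl.
Qed.

(** Lebesgue differentiation on the line, applied to [u] cut off outside the unit interval. *)
Lemma cell_average_cvg u : {ae mu, forall x, D x ->
  (mesh n)^-1 * cell_mass u (cell_left x n) n @[n --> \oo] --> (u x : R)}.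
Proof.
have mD : measurable D by exact: measurable_itv.
have intD : leb.-integrable D (EFin \o u).
  apply/integrableP; have mu' : measurable_fun setT (EFin \o u).
    by apply/measurable_EFinP; exact: measurable_L.
  split; first exact: measurable_funS mu'.
  have /integrableP [_] := L_integrable u measurableT.
  rewrite unit_interval_integral //; last exact: measurableT_comp.
  by rewrite -integral_mkcond.
have locu := integrable_locally_restrict mD intD.
have h := ae_unit_interval (lebesgue_differentiation locu).
have FF : Filter (almost_everywhere mu) by exact: ae_filter_ringOfSetsType.
apply: filterS h => x ux Dx.
have := nice_lebesgue_differentiation cell_nicely_shrinking locu ux.
rewrite patchE mem_set // => cv.
have eqn n : ((leb (cell (cell_left x n) n))^-1 *
    \int[leb]_(y in cell (cell_left x n) n) ((u \_ D) y)%:E)%E =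
    ((mesh n)^-1 * cell_mass u (cell_left x n) n)%:E.
  have mc := measurable_cell (cell_left x n) n.
  rewrite leb_cell inver gt_eqF ?mesh_gt0 // EFinM; congr (_ * _)%E.
  rewrite /cell_mass /Rintegral fineK; last exact: integrable_fin_num (L_integrable u mc).
  rewrite unit_interval_integral //; last first.
    by have /integrableP [] := L_integrable u mc.
  by apply: eq_integral => y _; rewrite !patchE; case: ifP.
have /fine_cvgP [_] : ((mesh n)^-1 * cell_mass u (cell_left x n) n)%:E
    @[n --> \oo] --> (u x)%:E by under eq_fun do rewrite -eqn.
by apply: cvg_trans; apply: near_eq_cvg; near=> n.
Unshelve. all: by end_near. Qed.

(* Fatou: the squared dyadic averages of [u] converge almost everywhere to [u ^+ 2]. *)
Lemma sq_le_haar u : sq u <= `|haar_map u| ^+ 2.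
Proof.
pose c n k := (mesh n)^-1 * dyadic_mass u n k.
(* The square of the step function of dyadic averages: at each point at most one term of the sum is
   nonzero. *)
pose E2 n x := \sum_(k < 2 ^ n) c n k ^+ 2 * \1_(cell (mesh n * k%:R) n) x.
have E2_ge0 n x : 0 <= E2 n x.
  by apply: sumr_ge0 => k _; rewrite mulr_ge0 ?sqr_ge0.
have mE2 n : measurable_fun setT (fun x => (E2 n x)%:E).
  apply/measurable_EFinP; apply: measurable_sum => k.
  apply: measurable_funM => //; apply: measurable_indic; exact: measurable_cell.
have iE2 n : (\int[mu]_x (E2 n x)%:E <= (`|haar_map u| ^+ 2)%:E)%E.
  apply: (@le_trans _ _ (dyadic_energy u n)%:E); last first.
    by rewrite lee_fin dyadic_energy_haar.
  under eq_integral do rewrite /E2 -sumEFin.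
  rewrite ge0_integral_sum //; last 2 first.
  - move=> k; apply/measurable_EFinP; apply: measurable_funM => //.
    by apply: measurable_indic; exact: measurable_cell.
  - by move=> k x _; rewrite lee_fin mulr_ge0 ?sqr_ge0.
  rewrite /dyadic_energy mulr_sumr -sumEFin; apply: lee_sum => k _.
  have mc := measurable_cell (mesh n * k%:R) n.
  under eq_integral do rewrite EFinM.
  rewrite ge0_integralZl ?lee_fin ?sqr_ge0 //; last first.
    by apply/measurable_EFinP; exact: measurable_indic.
  rewrite integral_indic // setIT.
  apply: (@le_trans _ _ ((c n k ^+ 2)%:E * (mesh n)%:E)%E).
    by apply: lee_wpmul2l; rewrite ?lee_fin ?sqr_ge0 // mu_cell.
  rewrite -EFinM lee_fin /c exprMn le_eqVlt; apply/orP; left; apply/eqP.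
  by field; rewrite gt_eqF // mesh_gt0.
have E2E n x : D x -> E2 n x = ((mesh n)^-1 * cell_mass u (cell_left x n) n) ^+ 2.
  move=> Dx; have [x0 x1] : 0 < x /\ x < 1.
    by move: Dx; rewrite /= in_itv /= => /andP.
  have m0 := mesh_gt0 R n; have xm : 0 <= x / mesh n by rewrite divr_ge0 // ltW.
  have mn : mesh n * (2 ^ n)%:R = 1.
    by rewrite /mesh exprVn natrX mulVf // expf_neq0.
  have kn : (Num.truncn (x / mesh n) < 2 ^ n)%N.
    rewrite truncn_lt_nat //.
    by rewrite ltr_pdivrMr // mulrC mn.
  rewrite /E2 (bigD1 (Ordinal kn)) //= big1 ?addr0 => [|k kneq].
    rewrite indicE mem_set ?mulr1 /c /dyadic_mass; last first.
      by have := cell_leftP x n; rewrite /cell_left ltW.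
    by rewrite /cell_left ltW.
  rewrite indicE memNset ?mulr0 // => /cellP [h1 h2].
  move/negP: kneq; apply; apply/eqP/val_inj => /=; apply/esym/truncn_def.
  rewrite ler_pdivlMr // mulrC h1 /= ltr_pdivrMr //.
  by rewrite -natr1 mulrDl mul1r [_%:R * _]mulrC.
have cv := cell_average_cvg u.
have FF : Filter (almost_everywhere mu) by exact: ae_filter_ringOfSetsType.
have Dae := ae_in_unit_interval R.
rewrite -lee_fin /sq /Rintegral fineK; last first.
  exact: integrable_fin_num (sq_integrable p2 mu1 u).
apply: (@le_trans _ _ (\int[mu]_x limn_einf (fun n => (E2 n x)%:E))%E).
  rewrite le_eqVlt; apply/orP; left; apply/eqP; apply: ae_eq_integral => //.
  - by have /integrableP [] := sq_integrable p2 mu1 u.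
  - rewrite (_ : (fun x => _) = (fun x => - limn_esup (fun n => - (E2 n x)%:E))%E).
      apply: measurableT_comp => //; apply: measurable_fun_limn_esup => n.
      by apply: measurableT_comp.
    by apply/funext => x; rewrite (limn_esupN (fun n => (E2 n x)%:E)) oppeK.
  apply: (filterS2 _ _ cv Dae) => x /= cx Dx _.
  have cvE : (E2 n x)%:E @[n --> \oo] --> (u x ^+ 2)%:E.
    under eq_fun do rewrite E2E //.
    apply: cvg_EFin; first exact: nearW.
    rewrite expr2; have h := cvgM (cx Dx) (cx Dx).
    exact: h.
  by have [-> _] := cvg_limn_einf_sup cvE.
have E2e n x : [set: measurableTypeR R] x -> (0 <= (E2 n x)%:E)%E by rewrite lee_fin.
apply: (le_trans (fatou mu measurableT mE2 E2e)).
rewrite limn_einf_lim; apply: lime_le; first exact: is_cvg_einfs.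
apply: nearW => n; apply: le_trans (iE2 n); apply: ereal_inf_lbound.
by exists n => /=.
Unshelve. all: by end_near. Qed.

End HaarLowerBound.

(** * Extension into injective spaces *)

Section DualBallEmbedding.
Variables (R : realType) (Z : completeNormedModType R).

Definition dual_ball := {phi : Z -> R |
  (forall a x y, phi (a *: x + y) = a * phi x + phi y) /\
  forall x, `|phi x| <= `|x|}.

Let evalP (z : Z) : (fun phi : dual_ball => sval phi z) \in @bounded_fct R dual_ball.
Proof. by apply/asboolP; exists `|z| => -[phi [h' h]]; exact: h. Qed.

Definition dual_eval (z : Z) : linfty R dual_ball := Linfty (evalP z).

Lemma dual_eval_linear a x y : dual_eval (a *: x + y) = a *: dual_eval x + dual_eval y.
Proof. by apply: val_inj; apply/funext => -[phi [h h']]; exact: h. Qed.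

Lemma norm_dual_eval z : `|dual_eval z| = `|z|.
Proof.
apply/eqP; rewrite eq_le; apply/andP; split.
  by apply: linfty_norm_le => // -[phi [h' h]]; exact: h.
have [phi [h1 h2 h3]] := norming_functional z.
rewrite -h3 (le_trans (ler_norm _)) //.
exact: (linfty_norm_ge (dual_eval z) (exist _ phi (conj h1 h2))).
Qed.

Lemma operator_dual_eval : operator dual_eval.
Proof.
split=> [a x y _ _|]; first exact: dual_eval_linear.
by exists 1 => x _; rewrite mul1r norm_dual_eval.
Qed.

(** The isometric image of a complete space is closed. Injectivity of [Z] can then be applied to the
    inverse on this range. *)
Lemma closed_range_dual_eval : closed_subspace (range dual_eval).
Proof.
split; last 2 first.
- by exists 0 => //; exact: (operator0 operator_dual_eval).
- by move=> a _ _ [x _ <-] [y _ <-]; exists (a *: x + y) => //; exact: dual_eval_linear.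
apply: closed_of_approx => f hf.
have /choice [z hz] n : exists z : Z, `|f - dual_eval z| < n.+1%:R^-1.
  have [|_ [z _ <-] h] := hf n.+1%:R^-1; first by rewrite invr_gt0.
  by exists z.
have hzz (x y : Z) : `|x - y| <= `|f - dual_eval x| + `|f - dual_eval y|.
  rewrite -norm_dual_eval (operatorB operator_dual_eval) -(distrC _ f).
  by apply: le_trans (ler_normD _ _); rewrite addrA subrK.
have small (e : R) : 0 < e -> exists N, forall n, (N <= n)%N -> n.+1%:R^-1 < e.
  move=> e0; exists (Num.truncn e^-1) => n Nn.
  rewrite invf_plt ?posrE //; apply: lt_le_trans (truncnS_gt _) _.
  by rewrite ler_nat.
have cz : cvg (z @ \oo).
  apply: cauchy_cvg; apply/cauchy_exP => e e0.
  have e2 : 0 < e / 2 by rewrite divr_gt0.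
  have [N hN] := small _ e2.
  exists (z N); exists N => // n /= Nn; rewrite -ball_normE /=.
  apply: le_lt_trans (hzz _ _) _; rewrite (splitr e).
  by apply: ltrD; apply: lt_trans (hz _) (hN _ _).
set l := lim (z @ \oo) in cz; exists l => //.
apply/eqP; rewrite -subr_eq0 -normr_le0 distrC.
apply/ler_addgt0Pr => e e0; rewrite add0r.
have e2 : 0 < e / 2 by rewrite divr_gt0.
have [N hN] := small _ e2.
have /cvgrPdist_lt /(_ _ e2) [N' _ hN'] := cz.
have h1 := hN' (maxn N N') (leq_maxr _ _).
have h2 := lt_trans (hz (maxn N N')) (hN _ (leq_maxl _ _)).
rewrite -norm_dual_eval (operatorB operator_dual_eval) in h1.
have := ler_normD (f - dual_eval (z (maxn N N'))) (dual_eval (z (maxn N N')) - dual_eval l).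
rewrite addrA subrK => /le_trans; apply; rewrite (splitr e) lerD //; first exact: ltW.
by rewrite distrC; exact: ltW.
Qed.

End DualBallEmbedding.

Section Splitting.
Variables (R : realType) (V Y : normedModType R) (A : V -> Y).
Hypothesis oA : operator A.

(** View [psi] as a functional on the graph of [A], dominated by [q]. Its extension [F] splits as
    [F (x, 0) + F (0, y)]: the first part inherits the constant [e], the second the constant [M]. *)
Lemma split_functional (psi : V -> R) (e M : R) : 0 <= e -> 0 <= M ->
  (forall a x y, psi (a *: x + y) = a * psi x + psi y) ->
  (forall x, `|psi x| <= e * `|x| + M * `|A x|) ->
  exists h : Y -> R, [/\ forall a x y, h (a *: x + y) = a * h x + h y,
    forall y, `|h y| <= M * `|y| & forall x, `|psi x - h (A x)| <= e * `|x|].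
Proof.
move=> e0 M0 psil psib.
pose q (u : V * Y) := e * `|u.1| + M * `|u.2|.
have qD u v : q (u + v) <= q u + q v.
  by rewrite /q addrACA -!mulrDr lerD // ler_wpM2l // ler_normD.
have qZ a u : 0 <= a -> q (a *: u) = a * q u.
  by move=> a0; rewrite /q /= !normrZ ger0_norm // mulrDr !(mulrCA a).
have [| | | |F [Fl Fq Ff]] := hahn_banach qD qZ (A := range (fun x => (x, A x)))
    (f := fun u => psi u.1).
- by exists 0 => //; rewrite (operator0 oA).
- move=> a _ _ [x _ <-] [y _ <-]; exists (a *: x + y) => //.
  by rewrite (operatorD oA) (operatorZ oA).
- by move=> a _ _ [x _ <-] [y _ <-]; exact: psil.
- by move=> _ [x _ <-]; apply: le_trans (ler_norm _) _; exact: psib.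
have F0 : F 0 = 0 by have := Fl (-1) 0 0; rewrite scaler0 addr0 mulN1r addNr.
have FN u : F (- u) = - F u.
  by have := Fl (-1) u 0; rewrite !addr0 scaleN1r F0 addr0 mulN1r.
have Fb u : `|F u| <= q u.
  rewrite ler_norml Fq andbT lerNl -FN; apply: le_trans (Fq _) _.
  by rewrite /q /= !normrN.
exists (fun y => F (0, y)); split=> [a x y|y|x].
- by rewrite -Fl; congr F; rewrite -[RHS]/(_, _) /= scaler0 addr0.
- by apply: le_trans (Fb _) _; rewrite /q /= normr0 mulr0 add0r.
have -> : psi x - F (0, A x) = F (x, 0).
  rewrite -(Ff (x, A x)); last by exists x.
  rewrite -FN -[F (x, A x)]mul1r -Fl; congr F.
  by rewrite scale1r -[LHS]/(_, _) /= subrr oppr0 addr0.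
by apply: le_trans (Fb _) _; rewrite /q /= normr0 mulr0 addr0.
Qed.

(* The constant of the extension must not depend on [e], so one bounded left
   inverse of the embedding of [Z] is fixed before [e] is chosen. *)
Lemma injective_factorization (Z : completeNormedModType R) (f : V -> Z) :
  injective_space Z -> operator f ->
  (forall e : R, 0 < e -> exists2 M : R, 0 <= M &
     forall x, `|f x| <= e * `|x| + M * `|A x|) ->
  forall e : R, 0 < e -> exists B : Y -> Z,
    operator B /\ forall x, `|f x - B (A x)| <= e * `|x|.
Proof.
move=> injZ opf est; pose i := @dual_eval R Z.
have oi : operator i := @operator_dual_eval R Z.
have i1 z : setT z -> 1 * `|z| <= `|i z| by rewrite mul1r norm_dual_eval.
have [_ [g [og gi _]]] :=
  bounded_below_isomorphism I (fun _ _ _ _ _ => I) oi ltr01 i1.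
have [v [ov vg]] := injZ _ _ _ (@closed_range_dual_eval R Z) og.
have vi z : v (i z) = z by rewrite vg; [case: (gi z I)|exists z].
(* The left inverse [v] multiplies errors by at most [K], hence the accuracy [e / K] asked for
   below. *)
have [K K0 vK] := operator_bound ov.
move=> e e0; have eK : 0 < e / K by rewrite divr_gt0.
have [M M0 fM] := est _ eK.
(* The functionals [h phi] are chosen independently of one another; linearity in [y] is checked for
   each [phi], and [M] bounds them uniformly. *)
have /choice [h hh] (phi : dual_ball Z) : exists h : Y -> R,
    [/\ forall a x y, h (a *: x + y) = a * h x + h y,
    forall y, `|h y| <= M * `|y| & forall x, `|sval phi (f x) - h (A x)| <= e / K * `|x|].
  case: phi => phi [phil phib] /=.
  apply: (split_functional (psi := fun x => phi (f x)) (ltW eK) M0) => [a x y|x].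
    by rewrite (operatorD opf) (operatorZ opf) phil.
  exact: le_trans (phib _) (fM x).
have hb y : (fun phi => h phi y) \in @bounded_fct R (dual_ball Z).
  by apply/asboolP; exists (M * `|y|) => phi; case: (hh phi).
pose H y : linfty R (dual_ball Z) := Linfty (hb y).
exists (v \o H); split=> [|x /=].
  split=> [a x y _ _ /=|].
    rewrite -ov.1 //; congr v; apply: val_inj; apply/funext => phi.
    by case: (hh phi) => h1 _ _; exact: h1.
  exists (K * M) => y _ /=; apply: le_trans (vK _) _; rewrite -mulrA ler_pM2l //.
  apply: linfty_norm_le => [|phi]; first exact: mulr_ge0.
  by case: (hh phi) => _ h2 _; exact: h2.
rewrite -[f x]vi -(operatorB ov); apply: le_trans (vK _) _.
rewrite mulrC -ler_pdivlMr // mulrAC.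
apply: linfty_norm_le => [|phi]; first by rewrite mulr_ge0 // ltW.
by case: (hh phi) => _ _ h3; exact: h3.
Qed.

End Splitting.

Theorem theorem3 (R : realType) (p : R) (hp : 2 < p)
    (T : Lp01 (lee1_gt2 hp) -> Lp01 (lee1_gt2 hp)) (hT : operator T)
    (hTs : ell_strictly_singular (lee1_gt2 hp) T)
    (Z : completeNormedModType R) (hZ : injective_space Z)
    (J : Lp01 (lee1_gt2 hp) -> Z) (hJ : isometric_embedding J)
    (e : R) (he : 0 < e) :
  exists S : Lp01 (lee1_gt2 hp) -> Z,
    [/\ operator S, factors_through_ell2 S & opnorm (J \o T \- S) < e].
Proof.
have [oJ nJ] := hJ; have oH := operator_haar_map hp.
have oJT : operator (J \o T) by exact: operator_comp.
(* The supremum in [opnorm] preserves weak inequalities only; the accuracy [e / 2] leaves room for a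
   strict one. *)
have [d d0|B [oB JTB]] := injective_factorization oH hZ oJT _ (divr_gt0 he (ltr0Sn R 1)).
  have [M M0 TM] :=
    strictly_singular_estimate hp (unit_interval_measureT R) hT hTs d0.
  exists M => // u; rewrite /= nJ (le_trans (TM u)) // lerD2l ler_wpM2l //.
  rewrite -[leRHS]ger0_norm // -sqrtr_sqr ler_sqrt ?sqr_ge0 //.
  exact: sq_le_haar.
exists (B \o @haar_map R p hp); split; first exact: operator_comp.
  by exists (@haar_map R p hp), B.
apply: (@le_lt_trans _ _ (e / 2)); last by rewrite ltr_pdivrMr // ltr_pMr // ltr1n.
apply: sup_le_ub => [|_ [u /= u1 <-]].
  by exists `|(J \o T \- (B \o @haar_map R p hp)) 0|, 0 => //=; rewrite normr0.
apply: le_trans (JTB u) _; by rewrite ler_piMr // divr_ge0 // ltW.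
Qed.
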